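(* Let $1\le k\le n$ and let $u_1,\dots,u_k\in\mathbb S^{n-1}$ be linearly independent. Let $f\in\mathcal K_1(\mathbb R^n)$ and $g_1,\dots,g_k,\psi_1,\dots,\psi_k\in\mathcal K_1(\mathbb R)$ (resp. $f\in\mathcal S(\mathbb R^n)$ and $g_1,\dots,g_k,\psi_1,\dots,\psi_k\in\mathcal S(\mathbb R)$), and assume that $$(g^k,\psi^k):=\prod_{i=1}^k(g_i,\psi_i)\ne 0,\qquad (g_i,\psi_i)=\int_{\mathbb R}\overline{g_i(s)}\,\psi_i(s)\,ds.$$ Then for every $t\in\mathbb R^n$ $$f(t)=\frac{1}{(g^k,\psi^k)}\int_{\mathbb R^n}\int_{\mathbb R^k}DS_{g^k,u^k}f(x^k,\xi)\,\psi^k_{u^k,x^k,\xi}(t)\,dx^k\,d\xi .$$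
   Context: $\mathbb S^{n-1}$ is the unit sphere of $\mathbb R^n$. $\mathcal K_1(\mathbb R^n)$ is the space of $\varphi\in C^\infty(\mathbb R^n)$ for which $\sup_{t\in\mathbb R^n,\,|\alpha|\le j}e^{j|t|}|\varphi^{(\alpha)}(t)|<\infty$ for all $j\in\mathbb N_0$. With $u^k=(u_1,\dots,u_k)$ and $x^k=(x_1,\dots,x_k)\in\mathbb R^k$, $\xi\in\mathbb R^n$, the $k$-directional short-time Fourier transform is $$DS_{g^k,u^k}f(x^k,\xi)=\int_{\mathbb R^n}f(t)\,\overline{g_1(u_1\cdot t-x_1)}\cdots\overline{g_k(u_k\cdot t-x_k)}\,e^{-2\pi i t\cdot\xi}\,dt,$$ and $$\psi^k_{u^k,x^k,\xi}(t)=\psi_1(u_1\cdot t-x_1)\cdots\psi_k(u_k\cdot t-x_k)\,e^{2\pi i t\cdot\xi}.$$ *)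

(* Defs.v *)
From HB Require Import structures.
From mathcomp Require Import all_boot all_order all_algebra.
From mathcomp Require Import all_classical all_reals all_analysis.
From mathcomp Require Import complex.

Set Implicit Arguments.
Unset Strict Implicit.
Unset Printing Implicit Defensive.

Import Order.TTheory GRing.Theory Num.Theory.
Import numFieldNormedType.Exports.

Local Open Scope classical_set_scope.
Local Open Scope ring_scope.
Local Open Scope complex_scope.

Section lebesgue_tuple.
Context {R : realType}.
Local Open Scope ereal_scope.

Definition cons_pair n (p : R * n.-tuple R) : n.+1.-tuple R :=
  [tuple of p.1 :: p.2].

Lemma measurable_cons_pair n :
  measurable_fun [set: R * n.-tuple R] (@cons_pair n).
Proof. exact: (measurable_cons measurable_fst measurable_snd). Qed.

Definition product_cons n (m : {sigma_finite_measure set (n.-tuple R) -> \bar R}) :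
    set (n.+1.-tuple R) -> \bar R :=
  pushforward (@lebesgue_measure R \x m) (@cons_pair n).

Section product_cons_measure.
Variables (n : nat) (m : {sigma_finite_measure set (n.-tuple R) -> \bar R}).

Let product_cons0 : product_cons m set0 = 0.
Proof. by rewrite /product_cons /pushforward preimage_set0 measure0. Qed.

Let product_cons_ge0 A : 0 <= product_cons m A.
Proof. by rewrite /product_cons /pushforward; apply: integral_ge0. Qed.

Let product_cons_sigma_additive : semi_sigma_additive (product_cons m).
Proof.
exact: (@measure_semi_sigma_additive _ _ _
  (measure_function_pushforward__canonical__measure_function_Measure
     (@lebesgue_measure R \x m) (@measurable_cons_pair n))).
Qed.

HB.instance Definition _ := isMeasure.Build _ _ _ (product_cons m)
  product_cons0 product_cons_ge0 product_cons_sigma_additive.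

(* Reproved because the library's sigma-finite instance on m1 \x m2 is shadowed
   by the one for products of subprobabilities. *)
Let product_cons_sigma_finite : sigma_finite setT (product_cons m).
Proof.
have /sigma_finiteP[F [TF ndF Foo]] := sigma_finiteT (@lebesgue_measure R).
have /sigma_finiteP[G [TG ndG Goo]] := sigma_finiteT m.
pose g (x : n.+1.-tuple R) := (thead x, [tuple of behead x]).
have mg : measurable_fun setT g.
  apply/measurable_fun_pair; [exact: measurable_tnth|exact: measurable_behead].
have gK p : g (cons_pair p) = p.
  by case: p => a t; congr pair; apply: val_inj.
exists (fun i => g @^-1` (F i `*` G i)).
  rewrite predeqE => x; split => // _.
  have [i _ Fi] : (\bigcup_i F i) (g x).1 by rewrite -TF.
  have [j _ Gj] : (\bigcup_i G i) (g x).2 by rewrite -TG.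
  exists (maxn i j) => //; split.
    by move: Fi; exact/subsetPset/ndF/leq_maxl.
  by move: Gj; exact/subsetPset/ndG/leq_maxr.
move=> i; have [mF Fi] := Foo i; have [mG Gi] := Goo i; split.
  by rewrite -[X in measurable X]setTI; apply: mg => //; exact: measurableX.
rewrite /product_cons /pushforward -comp_preimage.
rewrite (_ : g \o _ = id); last by apply/funext => p; exact: gK.
by rewrite preimage_id product_measure1E// lte_mul_pinfty// ge0_fin_numE.
Qed.
HB.instance Definition _ := Measure_isSigmaFinite.Build _ _ _ (product_cons m)
  product_cons_sigma_finite.

End product_cons_measure.

(* Lebesgue measure on R^n as the n-fold product measure; R^n is carried by
   n.-tuple R because the library has a product sigma-algebra there and none on
   row vectors. *)
Fixpoint lebesgue_tuple (n : nat) :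
    {sigma_finite_measure set (n.-tuple R) -> \bar R} :=
  match n with
  | 0 => \d_[tuple]
  | n'.+1 => product_cons (lebesgue_tuple n')
  end.

Lemma lebesgue_tuple_box n (A : 'I_n -> set R) :
  (forall i, measurable (A i)) ->
  lebesgue_tuple n [set x : n.-tuple R | forall i, A i (tnth x i)] =
  \prod_(i < n) (@lebesgue_measure R (A i)).
Proof.
elim: n A => [|n IH] A mA.
  by rewrite big_ord0 /= diracE mem_set // => -[].
rewrite big_ord_recl -IH //= /product_cons /pushforward -product_measure1E //.
  congr (_ _); apply/seteqP; split => -[a x] /=.
    move=> H; split; first exact: (H ord0).
    by move=> i; have := H (lift ord0 i); rewrite tnthS.
  move=> [Ha H] i; case: (unliftP ord0 i) => [j|] -> //.
  by rewrite tnthS; exact: H.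
  exact: mA.
rewrite [X in measurable X](_ : _ = \big[setI/setT]_(i < n)
    ((fun x : n.-tuple R => tnth x i) @^-1` A (lift ord0 i))).
  apply: big_ind => // [B C|i _]; first exact: measurableI.
  by rewrite -[X in measurable X]setTI; apply: measurable_tnth.
apply/seteqP; split => x /=.
  by move=> H; rewrite -bigcap_seq => i _ /=; exact: H.
by rewrite -bigcap_seq => H i; apply: (H i); rewrite /= mem_index_enum.
Qed.

End lebesgue_tuple.

Section complex_integral.
Context d {T : measurableType d} {R : realType}.
Variable mu : {measure set T -> \bar R}.

Definition cintegrable (f : T -> R[i]) : Prop :=
  mu.-integrable setT (fun x => (complex.Re (f x))%:E) /\
  mu.-integrable setT (fun x => (complex.Im (f x))%:E).

Definition cintegral (f : T -> R[i]) : R[i] :=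
  (\int[mu]_x complex.Re (f x)) +i* (\int[mu]_x complex.Im (f x)).

End complex_integral.

Section euclidean.
Context {R : realType}.

Definition dotp n (v w : 'rV[R]_n) : R := \sum_(i < n) v 0 i * w 0 i.

Definition enorm n (v : 'rV[R]_n) : R := Num.sqrt (dotp v v).

Definition on_sphere n (v : 'rV[R]_n) : Prop := enorm v = 1.

Definition row_of_tuple n (x : n.-tuple R) : 'rV[R]_n := \row_i tnth x i.

Definition integrable_Rn n (f : 'rV[R]_n -> R[i]) : Prop :=
  cintegrable (lebesgue_tuple n) (f \o @row_of_tuple n).

Definition integral_Rn n (f : 'rV[R]_n -> R[i]) : R[i] :=
  cintegral (lebesgue_tuple n) (f \o @row_of_tuple n).

End euclidean.

Section test_functions.
Context {R : realType}.

Definition iter_partial n (s : seq 'I_n) (f : 'rV[R]_n -> R) : 'rV[R]_n -> R :=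
  foldr (fun (i : 'I_n) h => fun t => 'D_(delta_mx 0 i) h t) f s.

(* C^oo as: every iterated partial derivative, taken in any order, exists and
   is continuous. *)
Definition smooth n (f : 'rV[R]_n -> R) : Prop :=
  forall s : seq 'I_n, continuous (iter_partial s f) /\
    forall (i : 'I_n) t, derivable (iter_partial s f) t (delta_mx 0 i).

Definition csmooth n (f : 'rV[R]_n -> R[i]) : Prop :=
  smooth (@complex.Re R \o f) /\ smooth (@complex.Im R \o f).

(* The order in which the partials are taken is immaterial for smooth f. *)
Definition mderiv n (alpha : 'I_n -> nat) (f : 'rV[R]_n -> R[i])
    (t : 'rV[R]_n) : R[i] :=
  let s := flatten [seq nseq (alpha i) i | i <- enum 'I_n] in
  iter_partial s (@complex.Re R \o f) t +i* iter_partial s (@complex.Im R \o f) t.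

Definition K1 n (f : 'rV[R]_n -> R[i]) : Prop :=
  csmooth f /\
  forall j : nat, has_ubound
    [set y | exists t (alpha : 'I_n -> nat), (\sum_(i < n) alpha i <= j)%N /\
       y = expR (j%:R * enorm t) * Normc.normc (mderiv alpha f t)].

Definition schwartz n (f : 'rV[R]_n -> R[i]) : Prop :=
  csmooth f /\
  forall alpha beta : 'I_n -> nat, has_ubound
    [set y | exists t : 'rV[R]_n,
       y = `|\prod_(i < n) t 0 i ^+ beta i|
           * Normc.normc (mderiv alpha f t)].

(* Identifies functions on R with functions on R^1. *)
Definition on_R1 (g : R -> R[i]) : 'rV[R]_1 -> R[i] := fun t => g (t 0 0).

End test_functions.

Section directional_stft.
Context {R : realType} {n k : nat}.
Implicit Types (f : 'rV[R]_n -> R[i]) (u : 'I_k -> 'rV[R]_n)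
  (x : 'rV[R]_k) (xi t : 'rV[R]_n) (g psi : 'I_k -> R -> R[i]).

(* e^(i theta) *)
Definition expi (theta : R) : R[i] := cos theta +i* sin theta.

Definition DS g u f x xi : R[i] :=
  integral_Rn (fun t : 'rV[R]_n =>
    f t * (\prod_(i < k) (g i (dotp (u i) t - x 0 i))^*)
        * expi (- (2 * pi * dotp t xi))).

Definition psik psi u x xi t : R[i] :=
  (\prod_(i < k) psi i (dotp (u i) t - x 0 i)) * expi (2 * pi * dotp t xi).

Definition pairing (a b : R -> R[i]) : R[i] :=
  cintegral (@lebesgue_measure R) (fun s => (a s)^* * b s).

End directional_stft.

(* Main.v *)
Require Import Defs.
From mathcomp Require Import all_boot all_order all_algebra.
From mathcomp Require Import all_classical all_reals all_analysis measurable_realfun.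
From mathcomp Require Import complex ring lra.

Set Implicit Arguments.
Unset Strict Implicit.
Unset Printing Implicit Defensive.

Import Order.TTheory GRing.Theory Num.Theory.
Import numFieldNormedType.Exports.

Local Open Scope classical_set_scope.
Local Open Scope ring_scope.
Local Open Scope complex_scope.

(** Write F_x(s) = f(s) prod_i conj(g_i(u_i.s - x_i)).  By definition the
    transform DS(x, xi) is the Fourier transform of F_x at xi, so Fourier
    inversion in xi gives back F_x(t) for every x.  Multiplying by
    prod_i psi_i(u_i.t - x_i) and integrating in x leaves
    f(t) prod_i int conj(g_i(y)) psi_i(y) dy, after the reflection
    y = u_i.t - x_i in each variable.  All the work goes into two points: the
    inversion formula, and the exchange of the x- and xi-integrals, since the
    theorem integrates in x first.

    Exchange.  Derivatives of f decay and those of the g_i are bounded, so F_x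
    and its derivatives are bounded by an integrable weight, uniformly in x
    ([ctame_windowed]).  Applying 1 - d_j^2 once in every variable then bounds
    DS(x, xi) by a constant multiple of prod_j 1/(1 + xi_j^2), uniformly in x
    ([fourier_decay]).  The integrand is thus dominated by a tensor product
    a(x) b(xi) of integrable functions, and Fubini's theorem applies
    ([cintegral_swap]).

    Inversion.  The inversion integral is regularised by the factor
    prod_j exp(-e |xi_j|).  Its Fourier transform is a product of Poisson
    kernels, so Fubini's theorem turns the regularised integral into a
    convolution with that product ([fourier_abel]); after the substitution
    s = t - e y the kernel does not depend on e ([poisson_affine]), and
    dominated convergence on both sides as e tends to 0 is the inversion formula
    ([fourier_inversion]).

    Integrals over R^n are integrals over tuples, evaluated one coordinate at a
    time; a derivative is only ever taken along a coordinate line. *)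

(** * Arithmetic of complex numbers *)

Local Notation normc := Normc.normc.

Section complex_arithmetic.
Context {R : realType}.
Implicit Types z w : R[i].

Lemma ReM z w :
  complex.Re (z * w) =
  complex.Re z * complex.Re w - complex.Im z * complex.Im w.
Proof. by case: z w => a b [c d]. Qed.

Lemma ImM z w :
  complex.Im (z * w) =
  complex.Re z * complex.Im w + complex.Im z * complex.Re w.
Proof. by case: z w => a b [c d]. Qed.

Lemma ReJ z : complex.Re z^* = complex.Re z.
Proof. by case: z. Qed.

Lemma ImJ z : complex.Im z^* = - complex.Im z.
Proof. by case: z. Qed.

Lemma complex_ext z w :
  complex.Re z = complex.Re w -> complex.Im z = complex.Im w -> z = w.
Proof. by case: z w => a b [c d] /= -> ->. Qed.

Lemma normc_ge0 z : 0 <= normc z.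
Proof. by case: z => a b; exact: sqrtr_ge0. Qed.

Lemma normc_Re z : `|complex.Re z| <= normc z.
Proof. by case: z => a b /=; rewrite -sqrtr_sqr ler_wsqrtr// lerDl sqr_ge0. Qed.

Lemma normc_Im z : `|complex.Im z| <= normc z.
Proof. by case: z => a b /=; rewrite -sqrtr_sqr ler_wsqrtr// lerDr sqr_ge0. Qed.

Lemma normc_ReIm z : normc z <= `|complex.Re z| + `|complex.Im z|.
Proof.
case: z => a b /=; rewrite -[leRHS]ger0_norm ?addr_ge0// -sqrtr_sqr ler_wsqrtr//.
by rewrite sqrrD !real_normK ?num_real// lerD2r lerDl mulrn_wge0// mulr_ge0.
Qed.

Lemma normc_prod (I : finType) (F : I -> R[i]) :
  normc (\prod_i F i) = \prod_i normc (F i).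
Proof.
apply: (big_morph _ (@Normc.normcM R)).
by rewrite /= expr0n addr0 expr1n sqrtr1.
Qed.

Lemma normc_real (x : R) : normc x%:C = `|x|.
Proof. by rewrite /= expr0n addr0 sqrtr_sqr. Qed.

Lemma normc_conj z : normc z^* = normc z.
Proof. by case: z => a b /=; rewrite sqrrN. Qed.

Lemma normc_expi (theta : R) : normc (expi theta) = 1.
Proof. by rewrite /= cos2Dsin2 sqrtr1. Qed.

Lemma expiD (a b : R) : expi (a + b) = expi a * expi b.
Proof.
apply: complex_ext; rewrite ?ReM ?ImM /= ?cosD ?sinD//.
by rewrite addrC [cos a * _]mulrC mulrC [X in _ + X]mulrC addrC.
Qed.

Lemma expi0 : expi (0 : R) = 1.
Proof. by rewrite /expi cos0 sin0. Qed.

Lemma expi_sum n (a : 'I_n -> R) : expi (\sum_i a i) = \prod_i expi (a i).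
Proof. exact: (big_morph _ expiD expi0). Qed.

End complex_arithmetic.

(** * Complex-valued integrals *)
Section measurable_complex.
Context d (T : measurableType d) {R : realType}.
Implicit Types f g : T -> R[i].

(** Tested on the two components, to match the definition of [cintegrable]. *)
Definition cmeas f :=
  measurable_fun setT (fun x => complex.Re (f x)) /\
  measurable_fun setT (fun x => complex.Im (f x)).

Lemma cmeasM f g : cmeas f -> cmeas g -> cmeas (fun x => f x * g x).
Proof.
move=> [f1 f2] [g1 g2]; split; under eq_fun do rewrite ?ReM ?ImM.
  by apply: measurable_funB; exact: measurable_funM.
by apply: measurable_funD; exact: measurable_funM.
Qed.

Lemma cmeas_cst (c : R[i]) : cmeas (fun=> c).
Proof. by split; exact: measurable_cst. Qed.

Lemma cmeas_conj f : cmeas f -> cmeas (fun x => (f x)^*).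
Proof.
move=> [f1 f2]; split; first by under eq_fun do rewrite ReJ.
by under eq_fun do rewrite ImJ; exact: measurable_funN.
Qed.

Lemma cmeas_prod n (f : 'I_n -> T -> R[i]) :
  (forall i, cmeas (f i)) -> cmeas (fun x => \prod_(i < n) f i x).
Proof.
elim: n f => [|n IH] f mf.
  by under eq_fun do rewrite big_ord0; exact: cmeas_cst.
under eq_fun do rewrite big_ord_recl.
by apply: cmeasM => //; exact: IH.
Qed.

Lemma cmeas_real (a : T -> R) :
  measurable_fun setT a -> cmeas (fun x => (a x)%:C).
Proof. by move=> ma; split => //=; exact: measurable_cst. Qed.

Lemma cmeas_expi (a : T -> R) :
  measurable_fun setT a -> cmeas (fun x => expi (a x)).
Proof.
move=> ma; split => /=.
  exact: measurableT_comp (continuous_measurable_fun (@continuous_cos R)) ma.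
exact: measurableT_comp (continuous_measurable_fun (@continuous_sin R)) ma.
Qed.

End measurable_complex.

Lemma cmeas_comp d d' (S : measurableType d) (T : measurableType d')
    {R : realType} (f : T -> R[i]) (h : S -> T) :
  cmeas f -> measurable_fun setT h -> cmeas (fun x => f (h x)).
Proof.
by move=> [f1 f2] mh; split;
  [exact: (measurableT_comp f1 mh)|exact: (measurableT_comp f2 mh)].
Qed.

Section integrable_complex.
Context d (T : measurableType d) {R : realType}.
Variable mu : {measure set T -> \bar R}.
Implicit Types (f g : T -> R[i]) (a b : T -> R).

Lemma rintegrable_dom a b : measurable_fun setT a ->
  (forall x, `|a x| <= b x) -> mu.-integrable setT (EFin \o b) ->
  mu.-integrable setT (EFin \o a).
Proof.
move=> ma ab; apply: le_integrable => //; first exact/measurable_EFinP.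
by move=> x _ /=; rewrite lee_fin (le_trans (ab x))// ler_norm.
Qed.

Lemma cintegrable_dom f b : cmeas f -> (forall x, normc (f x) <= b x) ->
  mu.-integrable setT (EFin \o b) -> cintegrable mu f.
Proof.
move=> [f1 f2] fb ib; split.
  by apply: (rintegrable_dom f1 _ ib) => x; exact: le_trans (normc_Re _) _.
by apply: (rintegrable_dom f2 _ ib) => x; exact: le_trans (normc_Im _) _.
Qed.

Lemma integrable_ReIm f : cintegrable mu f ->
  mu.-integrable setT
    (EFin \o (fun x => `|complex.Re (f x)| + `|complex.Im (f x)|)).
Proof.
move=> [f1 f2].
exact: (integrableD measurableT (integrable_norm f1) (integrable_norm f2)).
Qed.

Lemma cintegrable_meas f : cintegrable mu f -> cmeas f.
Proof.
by move=> [/measurable_int/measurable_EFinP ? /measurable_int/measurable_EFinP].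
Qed.

Lemma cintegralZl (c : R[i]) f : cintegrable mu f ->
  cintegral mu (fun x => c * f x) = c * cintegral mu f.
Proof.
move=> [f1 f2]; apply: complex_ext; rewrite ?ReM ?ImM /=.
  under eq_Rintegral do rewrite ReM.
  rewrite RintegralB// ?RintegralZl//.
  - exact: (integrableZl _ _ f1).
  - exact: (integrableZl _ _ f2).
under eq_Rintegral do rewrite ImM.
rewrite RintegralD// ?RintegralZl//.
- exact: (integrableZl _ _ f2).
- exact: (integrableZl _ _ f1).
Qed.

Lemma cintegralZr (c : R[i]) f : cintegrable mu f ->
  cintegral mu (fun x => f x * c) = cintegral mu f * c.
Proof.
move=> fi; rewrite [RHS]mulrC -cintegralZl//.
by congr cintegral; apply/funext => x; rewrite mulrC.
Qed.

End integrable_complex.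

(** * Fubini's theorem under a product bound *)

(** If |h(x, y)| <= a(x) b(y) with a and b integrable, then every section of h is
    integrable, and not only almost every one.  Inner integrals are then genuine
    numbers everywhere, which is the form in which the iterated integrals of the
    theorem are stated. *)
Section fubini_dominated.
Context d1 d2 (T1 : measurableType d1) (T2 : measurableType d2) {R : realType}.
Variables (m1 : {sigma_finite_measure set T1 -> \bar R})
          (m2 : {sigma_finite_measure set T2 -> \bar R}).
Variables (a : T1 -> R) (b : T2 -> R).
Hypotheses (ia : m1.-integrable setT (EFin \o a))
           (ib : m2.-integrable setT (EFin \o b)).

Lemma integrable_tensor :
  (m1 \x m2)%E.-integrable setT (fun p => (a p.1 * b p.2)%:E).
Proof.
have [/measurable_EFinP ma la] := integrableP _ _ _ ia.
have [/measurable_EFinP mb lb] := integrableP _ _ _ ib.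
have mab : measurable_fun setT (fun p : T1 * T2 => a p.1 * b p.2).
  by apply: measurable_funM; exact: measurableT_comp.
apply/integrable12ltyP; first exact/measurable_EFinP.
under eq_integral => x _.
  under eq_integral do rewrite /= normrM EFinM.
  rewrite ge0_integralZl//; last first.
    by apply/measurable_EFinP; exact: measurableT_comp.
  over.
rewrite /= ge0_integralZr//.
- by rewrite lte_mul_pinfty// ?integral_ge0// ge0_fin_numE// integral_ge0.
- by apply/measurable_EFinP; exact: measurableT_comp.
- exact: integral_ge0.
Qed.

Section real_valued.
Variable h : T1 * T2 -> R.
Hypotheses (mh : measurable_fun setT h)
           (h_le : forall x y, `|h (x, y)| <= a x * b y).

Lemma integrable_dominated_prod :
  (m1 \x m2)%E.-integrable setT (EFin \o h).
Proof. by apply: (rintegrable_dom mh _ integrable_tensor) => -[x y]. Qed.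

Lemma integrable_dominated_l x : m2.-integrable setT (fun y => (h (x, y))%:E).
Proof.
apply: (@rintegrable_dom _ _ _ _ (fun y => h (x, y)) (fun y => a x * b y)).
- exact: measurableT_comp.
- by [].
- exact: (integrableZl measurableT (a x) ib).
Qed.

Lemma integrable_dominated_r y : m1.-integrable setT (fun x => (h (x, y))%:E).
Proof.
apply: (@rintegrable_dom _ _ _ _ (fun x => h (x, y)) (fun x => b y * a x)).
- exact: measurableT_comp.
- by move=> x; rewrite mulrC.
- exact: (integrableZl measurableT (b y) ia).
Qed.

Lemma integrable_fubini_r :
  m2.-integrable setT (fun y => (\int[m1]_x h (x, y))%:E).
Proof.
apply: (@rintegrable_dom _ _ _ _ _ (fun y => (\int[m1]_x a x) * b y)).
- apply: (@measurableT_comp _ _ _ _ _ _ (@fine R)) => //.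
  exact: measurable_fubini_G integrable_dominated_prod.
- move=> y; rewrite mulrC -RintegralZl//.
  have ihy := integrable_dominated_r y.
  apply: le_trans (le_normr_Rintegral _ ihy) _ => //.
  apply: le_Rintegral => //.
  + exact: (integrable_norm ihy).
  + exact: (integrableZl measurableT (b y) ia).
  + by move=> x _; rewrite mulrC.
- exact: (integrableZl measurableT (\int[m1]_x a x) ib).
Qed.

Lemma Rintegral_prod :
  \int[(m1 \x m2)%E]_p h p = \int[m1]_x (\int[m2]_y h (x, y)).
Proof.
rewrite /Rintegral -integral12_prod_meas1; last exact: integrable_dominated_prod.
congr fine; apply: eq_integral => x _.
rewrite fineK//; exact/integrable_fin_num/integrable_dominated_l.
Qed.

Lemma Rintegral_swap : \int[m1]_x (\int[m2]_y h (x, y)) =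
  \int[m2]_y (\int[m1]_x h (x, y)).
Proof.
rewrite -Rintegral_prod /Rintegral -integral21_prod_meas1; last first.
  exact: integrable_dominated_prod.
congr fine; apply: eq_integral => y _.
rewrite fineK//; exact/integrable_fin_num/integrable_dominated_r.
Qed.

End real_valued.

Section complex_valued.
Variable h : T1 * T2 -> R[i].
Hypotheses (mh : cmeas h) (h_le : forall x y, normc (h (x, y)) <= a x * b y).

Let mre := mh.1.
Let mim := mh.2.
Let re_le x y : `|complex.Re (h (x, y))| <= a x * b y.
Proof. exact: le_trans (normc_Re _) _. Qed.
Let im_le x y : `|complex.Im (h (x, y))| <= a x * b y.
Proof. exact: le_trans (normc_Im _) _. Qed.

Lemma cintegrable_dominated_prod : cintegrable (m1 \x m2)%E h.
Proof.
by split; apply: (@integrable_dominated_prod (fun p => _ (h p))).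
Qed.

Lemma cintegrable_dominated_r y : cintegrable m1 (fun x => h (x, y)).
Proof. by split; apply: (@integrable_dominated_r (fun p => _ (h p))). Qed.

Lemma cintegrable_fubini_r :
  cintegrable m2 (fun y => cintegral m1 (fun x => h (x, y))).
Proof. by split; apply: (@integrable_fubini_r (fun p => _ (h p))). Qed.

Lemma cintegral_prod : cintegral (m1 \x m2)%E h =
  cintegral m1 (fun x => cintegral m2 (fun y => h (x, y))).
Proof.
by apply: complex_ext; apply: (@Rintegral_prod (fun p => _ (h p))).
Qed.

Lemma cintegral_swap :
  cintegral m1 (fun x => cintegral m2 (fun y => h (x, y))) =
  cintegral m2 (fun y => cintegral m1 (fun x => h (x, y))).
Proof.
by apply: complex_ext; apply: (@Rintegral_swap (fun p => _ (h p))).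
Qed.

End complex_valued.
End fubini_dominated.

Lemma Rintegral_cvg d (T : measurableType d) {R : realType}
    (mu : {measure set T -> \bar R}) (f_ : nat -> T -> R) (f b : T -> R) :
  (forall n, measurable_fun setT (f_ n)) -> (forall n x, `|f_ n x| <= b x) ->
  mu.-integrable setT (EFin \o b) ->
  (forall x, f_ n x @[n --> \oo] --> f x) ->
  (\int[mu]_x f_ n x) @[n --> \oo] --> \int[mu]_x f x.
Proof.
move=> mf fb ib cf.
have mlim : measurable_fun setT f by exact: (measurable_fun_cvg (h := f_)).
have [] := @dominated_convergence _ _ _ mu setT measurableT
  (fun n x => (f_ n x)%:E) (fun x => (f x)%:E) (EFin \o b).
- by move=> n; exact/measurable_EFinP.
- exact/measurable_EFinP.
- by apply: aeW => x _; apply: cvg_EFin; [exact: nearW|exact: cf].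
- exact: ib.
- by apply: aeW => x n _ /=; rewrite lee_fin.
move=> ifi _; rewrite -[X in _ --> X]fineK; last exact: integrable_fin_num.
by move=> /fine_cvgP[_].
Qed.

(** * Integration over tuples *)
Section tuple_integration.
Context {R : realType}.
Notation leb := (@lebesgue_measure R).

Let mcons n :
  measurable_fun [set: measurableTypeR R * n.-tuple R] (@cons_pair R n).
Proof. exact: measurable_cons_pair. Qed.

Lemma tnth_cons_pair0 n (p : R * n.-tuple R) : tnth (cons_pair p) ord0 = p.1.
Proof. by []. Qed.

Lemma tnth_cons_pairS n (p : R * n.-tuple R) i :
  tnth (cons_pair p) (lift ord0 i) = tnth p.2 i.
Proof. exact: tnthS. Qed.

Lemma ge0_integral_cons n (h : n.+1.-tuple R -> \bar R) :
  measurable_fun setT h -> (forall x, 0 <= h x)%E ->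
  (\int[lebesgue_tuple n.+1]_x h x =
   \int[(leb \x lebesgue_tuple n)%E]_p h (cons_pair p))%E.
Proof.
move=> mh h0.
by rewrite -(ge0_integral_pushforward (@mcons n)
  (leb \x lebesgue_tuple n)%E measurableT mh (fun x _ => h0 x)).
Qed.

Lemma integrable_cons n (h : n.+1.-tuple R -> R) :
  measurable_fun setT h ->
  (leb \x lebesgue_tuple n)%E.-integrable setT (EFin \o (h \o @cons_pair R n)) ->
  (lebesgue_tuple n.+1).-integrable setT (EFin \o h).
Proof.
move=> mh ih; have mh' : measurable_fun setT (EFin \o h) by exact/measurable_EFinP.
exact: (integrable_pushforward (@mcons n) mh' ih measurableT).
Qed.

Lemma Rintegral_cons n (h : n.+1.-tuple R -> R) :
  measurable_fun setT h ->
  (leb \x lebesgue_tuple n)%E.-integrable setT (EFin \o (h \o @cons_pair R n)) ->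
  \int[lebesgue_tuple n.+1]_x h x =
  \int[(leb \x lebesgue_tuple n)%E]_p h (cons_pair p).
Proof.
move=> mh ih; have mh' : measurable_fun setT (EFin \o h) by exact/measurable_EFinP.
congr fine.
exact: (integral_pushforward (@mcons n) mh' ih measurableT).
Qed.

Lemma measurable_prod_tnth n (a : 'I_n -> R -> R) :
  (forall i, measurable_fun setT (a i)) ->
  measurable_fun setT (fun x : n.-tuple R => \prod_(i < n) a i (tnth x i)).
Proof.
move=> ma; apply: measurable_prod => i _.
by apply: measurableT_comp => //; exact: measurable_tnth.
Qed.

Lemma integrable_prod_tnth n (a : 'I_n -> R -> R) :
  (forall i, leb.-integrable setT (EFin \o a i)) ->
  (lebesgue_tuple n).-integrable setT
    (fun x => (\prod_(i < n) a i (tnth x i))%:E).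
Proof.
elim: n a => [|n IH] a ia.
  under eq_fun do rewrite big_ord0.
  apply: (@measurable_bounded_integrable _ _ _ _ (fun=> 1)) => //.
  - by rewrite /= diracT ltry.
  - exact: bounded_cst.
have ma i : measurable_fun setT (a i).
  by apply/measurable_EFinP; exact: measurable_int (ia i).
apply: (@integrable_cons _ (fun x => \prod_(i < n.+1) a i (tnth x i))).
  exact: measurable_prod_tnth.
have := integrable_tensor (ia ord0) (IH (fun i => a (lift ord0 i)) _).
move=> /(_ (fun i => ia (lift ord0 i))); apply: eq_integrable => // p _ /=.
rewrite big_ord_recl tnth_cons_pair0; congr (_ * _)%:E.
by apply: eq_bigr => i _; rewrite tnth_cons_pairS.
Qed.

Lemma cintegral_prod_tnth n (f : 'I_n -> R -> R[i]) :
  (forall i, cintegrable leb (f i)) ->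
  cintegral (lebesgue_tuple n) (fun x => \prod_(i < n) f i (tnth x i)) =
  \prod_(i < n) cintegral leb (f i).
Proof.
elim: n f => [|n IH] f fi.
  rewrite big_ord0 /cintegral /Rintegral.
  under eq_integral do rewrite big_ord0.
  under [X in _ +i* fine X]eq_integral do rewrite big_ord0.
  by rewrite !integral_dirac//= indicT mul1r mulr0.
pose b i (x : R) : R := `|complex.Re (f i x)| + `|complex.Im (f i x)|.
have ib i : leb.-integrable setT (EFin \o b i) by exact: integrable_ReIm.
have mf i : cmeas (f i) := cintegrable_meas (fi i).
have mfn m (k : 'I_m -> 'I_n.+1) :
    cmeas (fun x : m.-tuple R => \prod_(i < m) f (k i) (tnth x i)).
  by apply: cmeas_prod => i; apply: cmeas_comp (mf _) _; exact: measurable_tnth.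
pose h (p : R * n.-tuple R) :=
  f ord0 p.1 * \prod_(i < n) f (lift ord0 i) (tnth p.2 i).
have hE p : \prod_(i < n.+1) f i (tnth (cons_pair p) i) = h p.
  rewrite big_ord_recl tnth_cons_pair0; congr (_ * _).
  by apply: eq_bigr => i _; rewrite tnth_cons_pairS.
have mh : cmeas h.
  apply: cmeasM; first exact: cmeas_comp (mf _) _.
  by apply: (cmeas_comp (mfn _ (lift ord0))); exact: measurable_snd.
have h_le x y : normc (h (x, y)) <=
    b ord0 x * \prod_(i < n) b (lift ord0 i) (tnth y i).
  rewrite /h Normc.normcM normc_prod ler_pM ?normc_ge0 ?normc_ReIm//.
    by apply: prodr_ge0 => i _; exact: normc_ge0.
  by apply: ler_prod => i _; rewrite normc_ge0 normc_ReIm.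
have ibn := integrable_prod_tnth (fun i => ib (lift ord0 i)).
have [ih1 ih2] := cintegrable_dominated_prod (ib ord0) ibn mh h_le.
transitivity (cintegral (leb \x lebesgue_tuple n)%E h).
  apply: complex_ext => /=; rewrite Rintegral_cons/=.
  - by under eq_Rintegral do rewrite hE.
  - exact: (mfn _ id).1.
  - by apply: eq_integrable ih1 => // p _ /=; rewrite hE.
  - by under eq_Rintegral do rewrite hE.
  - exact: (mfn _ id).2.
  - by apply: eq_integrable ih2 => // p _ /=; rewrite hE.
rewrite (cintegral_prod (ib ord0) ibn mh h_le) big_ord_recl -IH//.
rewrite -cintegralZr//; congr cintegral; apply/funext => x.
rewrite /h /= cintegralZl//; apply: (cintegrable_dom _ _ ibn).
  exact: mfn.
move=> y; rewrite normc_prod; apply: ler_prod => i _.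
by rewrite normc_ge0 normc_ReIm.
Qed.

End tuple_integration.

(** * Substitution and the fundamental theorem of calculus *)

(** A substitution rule for nonnegative functions passes to integrable ones
    through positive and negative parts. *)
Section substitution.
Context d (T : measurableType d) {R : realType}.
Variables (mu : {measure set T -> \bar R}) (phi : T -> T) (k : R).
Hypotheses (k0 : 0 < k) (mphi : measurable_fun setT phi).
Hypothesis ge0_subst : forall h : T -> \bar R, measurable_fun setT h ->
  (forall x, 0 <= h x)%E -> (\int[mu]_x h x = k%:E * \int[mu]_y h (phi y))%E.

Lemma integrable_subst (h : T -> R) : mu.-integrable setT (EFin \o h) ->
  mu.-integrable setT (EFin \o (h \o phi)).
Proof.
move=> /integrableP[mh lth].
have mhp : measurable_fun setT (EFin \o h \o phi) by exact: measurableT_comp.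
apply/integrableP; split => //; move: lth.
rewrite ge0_subst//; last exact: measurableT_comp.
move=> lth; rewrite ltey; apply/eqP => E; move: lth; rewrite E.
by rewrite gt0_muley ?ltxx// lte_fin.
Qed.

Lemma Rintegral_subst (h : T -> R) : mu.-integrable setT (EFin \o h) ->
  \int[mu]_x h x = \int[mu]_y (k * h (phi y)).
Proof.
move=> ih; have ihp := integrable_subst ih.
have mh : measurable_fun setT (EFin \o h) := measurable_int _ ih.
rewrite RintegralZl// /Rintegral -(@fineM _ k%:E)//; last first.
  exact: integrable_fin_num.
congr fine; rewrite integralE [in RHS]integralE muleBr//; last first.
  apply: fin_num_adde_defr.
  exact: integrable_pos_fin_num.
congr (_ - _)%E; rewrite ge0_subst//.
- congr (_ * integral _ _ _)%E.
  exact: esym (funepos_comp (EFin \o h) phi).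
- exact: measurable_funepos.
- congr (_ * integral _ _ _)%E.
  exact: esym (funeneg_comp (EFin \o h) phi).
- exact: measurable_funeneg.
Qed.

End substitution.

Section affine_substitution.
Context {R : realType}.
Notation leb := (@lebesgue_measure R).

Definition affine1 (e t : R) (y : measurableTypeR R) : measurableTypeR R := t - e * y.

Lemma measurable_affine1 e t : measurable_fun setT (affine1 e t).
Proof.
by apply: measurable_funB; [exact: measurable_cst|exact: measurable_funM].
Qed.

Definition affine1_image e t : {measure set (measurableTypeR R) -> \bar R} :=
  measure_function_pushforward__canonical__measure_function_Measure
    leb (measurable_affine1 e t).

(** Both sides are measures, hence are compared on half-open intervals. *)
Lemma lebesgue_affine1 (e : {posnum R}) t (A : set R) : measurable A ->
  leb A = mscale (e%:num)%:nng (affine1_image e%:num t) A.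
Proof.
move=> mA; apply: lebesgue_measure_unique => //= _ [[a b]] _ <-.
rewrite /mscale /= /pushforward.
rewrite (_ : _ @^-1` _ = `[(t - b) / e%:num, (t - a) / e%:num[%classic); last first.
  apply/seteqP; split=> y /=; rewrite /affine1 !in_itv/=.
    move=> /andP[h1 h2]; rewrite ler_pdivrMr// ltr_pdivlMr//.
    by apply/andP; split; lra.
  rewrite ler_pdivrMr// ltr_pdivlMr// => /andP[h1 h2].
  by apply/andP; split; lra.
rewrite !lebesgue_measure_itv/= !lte_fin ltr_pM2r//.
rewrite ltrD2l ltrN2; case: ifPn => _; last by rewrite mule0.
rewrite -!EFinD -EFinM; congr (_%:E).
by field.
Qed.

Lemma ge0_integral_affine1 (e t : R) (h : R -> \bar R) : 0 < e ->
  measurable_fun setT h -> (forall x, 0 <= h x)%E ->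
  (\int[leb]_x h x = e%:E * \int[leb]_y h (t - e * y)%R)%E.
Proof.
move=> e0 mh h0; pose ep := PosNum e0.
rewrite (eq_measure_integral (mscale (ep%:num)%:nng
  (affine1_image ep%:num t))) /=; last first.
  by move=> A mA _; exact: (lebesgue_affine1 ep).
rewrite ge0_integral_mscale//.
rewrite (ge0_integral_pushforward (measurable_affine1 e t) leb measurableT mh)//.
Qed.

Definition affine n (e : R) (t y : n.-tuple R) : n.-tuple R :=
  [tuple tnth t i - e * tnth y i | i < n].

Lemma measurable_affine n (e : R) (t : n.-tuple R) :
  measurable_fun setT (affine e t).
Proof.
apply/measurable_fun_tnthP => i.
rewrite (_ : _ \o _ = fun y : n.-tuple R => tnth t i - e * tnth y i); last first.
  by apply/funext => y /=; rewrite tnth_mktuple.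
apply: measurable_funB; first exact: measurable_cst.
by apply: measurable_funM; [exact: measurable_cst|exact: measurable_tnth].
Qed.

(** By Tonelli's theorem the variables can be substituted one after the other,
    and each contributes one factor e. *)
Lemma ge0_integral_affine n (e : R) (t : n.-tuple R) (h : n.-tuple R -> \bar R) :
  0 < e -> measurable_fun setT h -> (forall x, 0 <= h x)%E ->
  (\int[lebesgue_tuple n]_x h x =
   (e ^+ n)%:E * \int[lebesgue_tuple n]_y h (affine e t y))%E.
Proof.
move=> e0; elim: n t h => [|n IH] t h mh h0.
  rewrite expr0 mul1e; apply: eq_integral => x _.
  by rewrite [x]tuple0 [affine _ _ _]tuple0.
pose t' := [tuple of behead t].
have affine_cons p : affine e t (cons_pair p) =
    cons_pair (thead t - e * p.1, affine e t' p.2).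
  apply: eq_from_tnth => i; rewrite tnth_mktuple.
  case: (unliftP ord0 i) => [j|] ->; last by [].
  rewrite !tnth_cons_pairS tnth_mktuple; congr (_ - _).
  by rewrite [in LHS](tuple_eta t) tnthS.
have mhc : measurable_fun setT (h \o @cons_pair R n).
  by apply: measurableT_comp => //; exact: measurable_cons_pair.
have mha : measurable_fun setT (h \o affine e t).
  by apply: measurableT_comp => //; exact: measurable_affine.
have mhac : measurable_fun setT (h \o affine e t \o @cons_pair R n).
  by apply: measurableT_comp => //; exact: measurable_cons_pair.
have mhr : measurable_fun setT
    (fun p : R * n.-tuple R => h (cons_pair (p.1, affine e t' p.2))).
  apply: (measurableT_comp mhc); apply/measurable_fun_pair => //=.
  by apply: measurableT_comp; first exact: measurable_affine.
rewrite !ge0_integral_cons// !fubini_tonelli1//.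
transitivity ((e ^+ n)%:E *
    \int[leb]_r \int[lebesgue_tuple n]_y h (cons_pair (r, affine e t' y)))%E.
  rewrite -ge0_integralZl//; last 3 first.
  - exact: (measurable_fun_fubini_tonelli_F _ mhr).
  - by move=> r _; exact: integral_ge0.
  - by rewrite lee_fin exprn_ge0// ltW.
  apply: eq_integral => r _; rewrite /fubini_F; apply: IH => //.
  apply: (measurableT_comp mhc); exact: measurable_pair1.
rewrite exprSr EFinM -muleA; congr (_ * _)%E.
rewrite (@ge0_integral_affine1 e (thead t))//; last 2 first.
- exact: (measurable_fun_fubini_tonelli_F _ mhr).
- by move=> r; exact: integral_ge0.
congr (_ * _)%E; apply: eq_integral => r _; apply: eq_integral => y _.
by rewrite affine_cons.
Qed.

Lemma Rintegral_affine n (e : R) (t : n.-tuple R) (h : n.-tuple R -> R) :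
  0 < e -> (lebesgue_tuple n).-integrable setT (EFin \o h) ->
  \int[lebesgue_tuple n]_x h x =
  \int[lebesgue_tuple n]_y (e ^+ n * h (affine e t y)).
Proof.
move=> e0; apply: Rintegral_subst.
- exact: exprn_gt0.
- exact: measurable_affine.
- by move=> ? ? ?; exact: ge0_integral_affine.
Qed.

Let ge0_reflect (c : R) (h : R -> \bar R) : measurable_fun setT h ->
  (forall x, 0 <= h x)%E ->
  (\int[leb]_x h x = 1%:E * \int[leb]_y h (affine1 1 c y))%E.
Proof. by move=> mh h0; exact: ge0_integral_affine1. Qed.

Lemma integrable_reflect (c : R) (h : R -> R) :
  leb.-integrable setT (EFin \o h) ->
  leb.-integrable setT (EFin \o (fun y => h (c - y))).
Proof.
move=> ih.
have := integrable_subst ltr01 (measurable_affine1 1 c) (ge0_reflect c) ih.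
by under [X in _.-integrable _ X]eq_fun do rewrite /= /affine1 mul1r.
Qed.

Lemma Rintegral_reflect (c : R) (h : R -> R) :
  leb.-integrable setT (EFin \o h) ->
  \int[leb]_y h (c - y) = \int[leb]_x h x.
Proof.
move=> ih.
rewrite (Rintegral_subst ltr01 (measurable_affine1 1 c) (ge0_reflect c) ih).
by under [RHS]eq_Rintegral do rewrite mul1r /affine1 mul1r.
Qed.

End affine_substitution.

Section fundamental_theorem_line.
Context {R : realType}.
Notation leb := (@lebesgue_measure R).

Lemma Rintegral_derivative (g G : R -> R) (a b : R) : a <= b -> continuous g ->
  (forall x : R, is_derive x 1 G (g x)) ->
  \int[leb]_(x in `[a, b]) g x = G b - G a.
Proof.
rewrite le_eqVlt => /predU1P[->|ab] cg dG.
  by rewrite set_itv1 Rintegral_set1 subrr.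
have cG : continuous G.
  by move=> x; apply/differentiable_continuous/derivable1_diffP; exact: ex_derive.
rewrite /Rintegral (@continuous_FTC2 _ _ G)//.
- exact: continuous_subspaceT.
- split.
  + by move=> x _; exact: ex_derive.
  + by apply: cvg_at_right_filter; exact: cG.
  + by apply: cvg_at_left_filter; exact: cG.
- by move=> x _; rewrite derive1E; exact: derive_val.
Qed.

(** A primitive on each half-line is enough, so that h may have a corner at 0, as
    exp(-|x|) does.  Truncation of h to [-n, n] is handled by dominated
    convergence. *)
Lemma Rintegral_pieces (h g1 G1 g2 G2 : R -> R) (l1 l2 : R) :
  leb.-integrable setT (EFin \o h) ->
  (forall x, 0 <= x -> h x = g1 x) -> (forall x, x <= 0 -> h x = g2 x) ->
  continuous g1 -> continuous g2 ->
  (forall x : R, is_derive x 1 G1 (g1 x)) -> (forall x : R, is_derive x 1 G2 (g2 x)) ->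
  (G1 n%:R @[n --> \oo] --> l1) -> (G2 (- n%:R) @[n --> \oo] --> l2) ->
  \int[leb]_x h x = (l1 - G1 0) + (G2 0 - l2).
Proof.
move=> ih h1 h2 cg1 cg2 dG1 dG2 cG1 cG2.
have mh : measurable_fun setT h by apply/measurable_EFinP; exact: measurable_int ih.
pose D (n : nat) : set R := `[- n%:R, n%:R]%classic.
have cutE n : \int[leb]_x (h \_ (D n)) x = (G1 n%:R - G1 0) + (G2 0 - G2 (- n%:R)).
  rewrite -Rintegral_mkcond /D.
  rewrite (@itv_bndbnd_setU _ _ _ (BRight 0)) ?bnd_simp ?oppr_le0//.
  rewrite Rintegral_setU//=; last 2 first.
  - by apply: integrableS ih => //; exact: measurableU.
  - apply/disj_setPS => y [/=]; rewrite 2!in_itv/= => /andP[_ y0] /andP[].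
    by rewrite ltNge y0.
  rewrite Rintegral_itv_obnd_cbnd; last exact: integrableS ih.
  rewrite addrC; congr (_ + _).
    rewrite -(Rintegral_derivative _ cg1 dG1)//; apply: eq_Rintegral => x.
    by rewrite inE/= in_itv/= => /andP[x0 _]; exact: h1.
  rewrite -(Rintegral_derivative _ cg2 dG2) ?oppr_le0//; apply: eq_Rintegral => x.
  by rewrite inE/= in_itv/= => /andP[_ x0]; exact: h2.
have cut_cvg : \int[leb]_x (h \_ (D n)) x @[n --> \oo] --> \int[leb]_x h x.
  apply: (@Rintegral_cvg _ _ _ leb (fun n => h \_ (D n)) h (fun x => `|h x|)).
  - move=> n; apply/(measurable_restrictT h (measurable_itv _)).
    exact: measurable_funTS.
  - by move=> n x; rewrite patchE; case: ifP; rewrite ?normr0.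
  - exact: integrable_norm.
  - move=> x; apply: cvg_near_cst; near=> n.
    rewrite patchE ifT// inE /D /= in_itv/= -ler_norml.
    by near: n; exact: nbhs_infty_ger.
have lim2 : \int[leb]_x (h \_ (D n)) x @[n --> \oo] --> (l1 - G1 0) + (G2 0 - l2).
  under eq_fun do rewrite cutE.
  apply: cvgD; first by apply: cvgB => //; exact: cvg_cst.
  by apply: cvgB => //; exact: cvg_cst.
exact: cvg_unique cut_cvg lim2.
Unshelve. all: end_near. Qed.

End fundamental_theorem_line.

(** * Functions of row vectors *)
Section row_vectors.
Context {R : realType}.
Notation leb := (@lebesgue_measure R).

Lemma cvg_row n (T : Type) (F : set_system T) {FF : Filter F}
    (f : T -> 'rV[R]_n) (l : 'rV[R]_n) :
  (forall j, f x 0 j @[x --> F] --> l 0 j) -> f x @[x --> F] --> l.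
Proof.
move=> fl; apply/cvg_ballP => e e0.
have : \forall x \near F, forall j, ball (l 0 j) e (f x 0 j).
  by apply: filter_forall => j; exact: cvg_ball.
by apply: filterS => x h; split => // i j; rewrite (ord1 i).
Qed.

(** The sigma-algebra of tuples is generated by the coordinates and not by the
    open sets.  The map x |-> floor((m+1) x) / (m+1) takes countably many values,
    each on a box, and tends to the identity; a continuous function is therefore
    a pointwise limit of measurable ones. *)
Lemma measurable_row_continuous n (F : 'rV[R]_n -> R) :
  continuous F -> measurable_fun setT (F \o @row_of_tuple R n).
Proof.
move=> cF; pose grid m (z : 'I_n -> int) : 'rV[R]_n := \row_j ((z j)%:~R / m.+1%:R).
pose z m (x : n.-tuple R) (j : 'I_n) := Num.floor (m.+1%:R * tnth x j).
pose F_ m (x : n.-tuple R) := F (grid m (z m x)).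
apply: (@measurable_fun_cvg _ _ _ _ F_) => [m|x _].
  move=> _ B mB; rewrite setTI.
  rewrite (_ : _ @^-1` _ = \bigcup_(w in [set: {ffun 'I_n -> int}])
     [set x | F (grid m w) \in B /\ forall j, z m x j = w j]); last first.
    apply/seteqP; split => x /=.
      move=> Bx; exists [ffun j => z m x j] => //=; split; last first.
        by move=> j; rewrite ffunE.
      rewrite inE; move: Bx; rewrite /F_; congr (B (F _)).
      by apply/rowP => j; rewrite !mxE ffunE.
    move=> [w _ [/set_mem Bw zw]]; move: Bw; rewrite /F_; congr (B (F _)).
    by apply/rowP => j; rewrite !mxE zw.
  apply: countable_bigcupT_measurable => // w.
  case: (boolP (F (grid m w) \in B)) => _; last first.
    by rewrite (_ : [set _ | _] = set0)// -subset0 => x [].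
  rewrite (_ : [set _ | _] = \bigcap_(j in [set: 'I_n])
     ((fun x : n.-tuple R => m.+1%:R * tnth x j) @^-1`
        `[(w j)%:~R, (w j + 1)%:~R[%classic)); last first.
    apply/seteqP; split => x /=.
      by move=> [_ h] j _ /=; rewrite in_itv/= -(h j) /z floor_itv.
    by move=> h; split => // j; apply: floor_def; have := h j I; rewrite /= in_itv.
  apply: fin_bigcap_measurable => // j _.
  rewrite -[X in measurable X]setTI.
  have : measurable_fun setT (fun x : n.-tuple R => m.+1%:R * tnth x j).
    by apply: measurable_funM; [exact: measurable_cst|exact: measurable_tnth].
  by apply.
apply: (continuous_cvg _ (cF _)); apply: cvg_row => j.
rewrite mxE; under eq_fun do rewrite mxE.
apply/cvgrPdist_le => e e0; near=> m.
have m0 : 0 < m.+1%:R :> R by [].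
have /andP[h1 h2] := floor_itv (m.+1%:R * tnth x j).
rewrite -/(z m x j) in h1 h2.
rewrite (_ : _ - _ = (m.+1%:R * tnth x j - (z m x j)%:~R) / m.+1%:R); last first.
  by field; rewrite gt_eqF.
rewrite normrM (ger0_norm (x := _^-1)) ?invr_ge0//.
rewrite ger0_norm ?subr_ge0// ler_pdivrMr//.
apply: (@le_trans _ _ 1); first by move: h2; rewrite intrD; lra.
rewrite mulrC -ler_pdivrMr// div1r (@le_trans _ _ m%:R) ?ler_nat//.
by near: m; exact: nbhs_infty_ger.
Unshelve. all: end_near. Qed.

Definition set_coord n (x : n.-tuple R) (j : 'I_n) (r : R) : n.-tuple R :=
  [tuple if i == j then r else tnth x i | i < n].

Lemma row_set_coord n (x : n.-tuple R) j r :
  row_of_tuple (set_coord x j r) = row_of_tuple (set_coord x j 0) + r *: delta_mx 0 j.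
Proof.
apply/rowP => i; rewrite !mxE !tnth_mktuple eqxx/=.
by case: ifP => _; rewrite ?add0r ?mulr1 ?mulr0 ?addr0.
Qed.

(** Fubini's theorem allows the j-th variable to be integrated first. *)
Lemma Rintegral_coord0 n (j : 'I_n) (h : n.-tuple R -> R) (C : R)
    (a : 'I_n -> R -> R) :
  measurable_fun setT h ->
  (forall i, leb.-integrable setT (EFin \o a i)) ->
  (forall x, `|h x| <= C * \prod_(i < n) a i (tnth x i)) ->
  (forall x, \int[leb]_r h (set_coord x j r) = 0) ->
  \int[lebesgue_tuple n]_x h x = 0.
Proof.
elim: n j h C a => [[]//|n IH] j h C a mh ia h_le h0.
have ian := integrable_prod_tnth (fun i => ia (lift ord0 i)).
have iCa : leb.-integrable setT (EFin \o (fun r => C * a ord0 r)).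
  exact: (integrableZl measurableT C (ia ord0)).
have mhc : measurable_fun setT (h \o @cons_pair R n).
  by apply: measurableT_comp => //; exact: measurable_cons_pair.
have hc_le r y : `|h (cons_pair (r, y))| <=
    C * a ord0 r * \prod_(i < n) a (lift ord0 i) (tnth y i).
  apply: le_trans (h_le _) _; rewrite big_ord_recl tnth_cons_pair0 mulrA.
  by under eq_bigr do rewrite tnth_cons_pairS.
have ihc := integrable_dominated_prod iCa ian mhc hc_le.
rewrite Rintegral_cons//.
rewrite (Rintegral_prod iCa ian mhc hc_le).
case: (unliftP ord0 j) => [i ji|j0].
  transitivity (\int[leb]_r (0 : R)); last by rewrite Rintegral_cst// mul0r.
  apply: eq_Rintegral => r _ /=.
  apply: (IH i _ (C * a ord0 r) (fun i => a (lift ord0 i))) => //.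
    exact: (measurableT_comp mhc (measurable_pair1 _)).
  move=> x; rewrite -[RHS](h0 (cons_pair (r, x))).
  apply: eq_Rintegral => s _; congr h; apply: eq_from_tnth => k.
  rewrite tnth_mktuple ji; case: (unliftP ord0 k) => [l|] -> //.
  by rewrite !tnth_cons_pairS tnth_mktuple (inj_eq lift_inj).
rewrite (Rintegral_swap iCa ian mhc hc_le).
transitivity (\int[lebesgue_tuple n]_y (0 : R)).
  apply: eq_Rintegral => y _ /=.
  rewrite -[RHS](h0 (cons_pair (0, y))).
  apply: eq_Rintegral => s _; congr h; apply: eq_from_tnth => k.
  rewrite tnth_mktuple j0; case: (unliftP ord0 k) => [l|] -> //.
  by rewrite !tnth_cons_pairS.
rewrite /Rintegral integral0//.
Qed.

(** A derivative in the direction v is an ordinary derivative along a line; this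
    is how one-variable calculus reaches functions of several variables. *)
Lemma derive_line n (G : 'rV[R]_n -> R) (t v : 'rV[R]_n) (r : R) :
  derivable G (t + r *: v) v ->
  is_derive r 1 (fun s => G (t + s *: v)) ('D_v G (t + r *: v)).
Proof.
have E : (fun h : R => h^-1 *: (((fun s => G (t + s *: v)) \o shift r) (h *: 1)
    - G (t + r *: v))) =
    (fun h : R => h^-1 *: ((G \o shift (t + r *: v)) (h *: v) - G (t + r *: v))).
  apply/funext => h /=; congr (_ *: (G _ - _)).
  by rewrite [h *: 1]mulr1 scalerDl addrCA.
by move=> dG; split; rewrite /derivable /derive E.
Qed.

End row_vectors.

Section cauchy_weight.
Context {R : realType}.
Notation leb := (@lebesgue_measure R).

Lemma oneDsqr_gt0 (x : R) : 0 < oneDsqr x.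
Proof. exact: lt_le_trans ltr01 (oneDsqr_ge1 x). Qed.

Lemma oneDsqrV_ge0 (x : R) : 0 <= (oneDsqr x)^-1.
Proof. by rewrite invr_ge0 ltW// oneDsqr_gt0. Qed.

Lemma integrable_oneDsqrV :
  leb.-integrable setT (fun x : R => ((oneDsqr x)^-1)%:E).
Proof.
apply/integrableP; split.
  by apply/measurable_EFinP; apply: continuous_measurable_fun; exact: continuous_oneDsqrV.
under eq_integral do rewrite /= ger0_norm ?oneDsqrV_ge0//.
rewrite ge0_symfun_integralT.
- by rewrite -set_itvcy integral0y_oneDsqr -EFinM ltry.
- by move=> x; rewrite oneDsqrV_ge0.
- exact: continuous_oneDsqrV.
- by move=> x /=; rewrite /oneDsqr sqrrN.
Qed.

Lemma oneDsqrV_cvg : ((oneDsqr (n%:R : R))^-1) @[n --> \oo] --> 0.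
Proof.
apply: (@squeeze_cvgr _ _ _ _ (fun=> 0) (@harmonic R)).
- apply: nearW => n; rewrite oneDsqrV_ge0/= lef_pV2 ?posrE ?oneDsqr_gt0//.
  rewrite /oneDsqr -natrX addrC natr1 ler_nat ltnS.
  by have [->//|n0] := posnP n; rewrite leq_pmulr.
- exact: cvg_cst.
- exact: cvg_harmonic.
Qed.

(** An integrable weight in product form: it suits iterated integration, and it
    bounds every Schwartz function up to a constant. *)
Definition cauchy n (t : 'rV[R]_n) : R := \prod_(j < n) (oneDsqr (t 0 j))^-1.

Lemma cauchy_gt0 n (t : 'rV[R]_n) : 0 < cauchy t.
Proof. by apply: prodr_gt0 => j _; rewrite invr_gt0 oneDsqr_gt0. Qed.

Lemma cauchy_row n (x : n.-tuple R) :
  cauchy (row_of_tuple x) = \prod_(j < n) (oneDsqr (tnth x j))^-1.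
Proof. by apply: eq_bigr => j _; rewrite mxE. Qed.

Lemma integrable_cauchy n (C : R) :
  (lebesgue_tuple n).-integrable setT
    (EFin \o (fun x : n.-tuple R => C * cauchy (row_of_tuple x))).
Proof.
have := integrableZl measurableT C
  (integrable_prod_tnth (fun _ : 'I_n => integrable_oneDsqrV)).
by apply: eq_integrable => // x _ /=; rewrite cauchy_row.
Qed.

End cauchy_weight.

Section directional_derivatives.
Context {R : realType}.

Lemma is_derive_line n (G : 'rV[R]_n -> R) (t v : 'rV[R]_n) (l : R) :
  is_derive (0 : R) 1 (fun s => G (t + s *: v)) l -> is_derive t v G l.
Proof.
have E : (fun h : R => h^-1 *: (((fun s => G (t + s *: v)) \o shift 0) (h *: 1)
    - G (t + 0 *: v))) =
    (fun h : R => h^-1 *: ((G \o shift t) (h *: v) - G t)).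
  apply/funext => h /=; congr (_ *: (G _ - G _)); last by rewrite scale0r addr0.
  by rewrite [h *: 1]mulr1 addr0 addrC.
by move=> [+ <-]; rewrite /derivable /derive E.
Qed.

Lemma dotpDl n (s t w : 'rV[R]_n) : dotp (s + t) w = dotp s w + dotp t w.
Proof. by rewrite -big_split; apply: eq_bigr => i _; rewrite mxE mulrDl. Qed.

Lemma dotpZl n (r : R) (t w : 'rV[R]_n) : dotp (r *: t) w = r * dotp t w.
Proof. by rewrite mulr_sumr; apply: eq_bigr => i _; rewrite mxE mulrA. Qed.

Lemma dotpC n (t w : 'rV[R]_n) : dotp t w = dotp w t.
Proof. by apply: eq_bigr => i _; rewrite mulrC. Qed.

Lemma dotp_delta n (j : 'I_n) (w : 'rV[R]_n) : dotp (delta_mx 0 j) w = w 0 j.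
Proof.
rewrite /dotp (bigD1 j)//= mxE !eqxx mul1r big1 ?addr0// => i ij.
by rewrite mxE (negbTE ij) andbF mul0r.
Qed.

Lemma continuous_dotp n (w : 'rV[R]_n) : continuous (fun t => dotp t w).
Proof.
apply: (continuous_big (op := +%R)); first exact: add_continuous.
move=> i _ t.
by apply: continuousM; [exact: coord_continuous|exact: cst_continuous].
Qed.

Lemma continuous_dotpr n (w : 'rV[R]_n) : continuous (dotp w).
Proof.
rewrite (_ : dotp w = (fun t => dotp t w)); first exact: continuous_dotp.
by apply/funext => t; exact: dotpC.
Qed.

End directional_derivatives.

(** * Families of functions with controlled derivatives *)
Section tame_families.
Context {R : realType} {n : nat} {X : Type}.
Implicit Types (W : 'rV[R]_n -> R) (F G : X -> 'rV[R]_n -> R).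

Let d_ (i : 'I_n) : 'rV[R]_n := delta_mx 0 i.

(** At most m derivatives are taken, the first along an index at most b and each
    next one along an index at most the previous one; all are bounded by a
    multiple of W, with the same constant for every member of the family.
    This order is the one in which the seminorms of the test functions take
    derivatives.  The uniformity in X is what later makes bounds on the transform
    uniform in the window position. *)
Fixpoint tame W (m b : nat) F : Prop :=
  [/\ forall x, continuous (F x),
      exists C, forall x t, `|F x t| <= C * W t &
      if m is m'.+1 then
        forall i : 'I_n, (i <= b)%N ->
          (forall x t, derivable (F x) t (d_ i)) /\
          tame W m' i (fun x t => 'D_(d_ i) (F x) t)
      else True].

Lemma tame_continuous W m b F : tame W m b F -> forall x, continuous (F x).
Proof. by case: m => [|m] []. Qed.

Lemma tame_bounded W m b F : tame W m b F ->
  exists C, forall x t, `|F x t| <= C * W t.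
Proof. by case: m => [|m] []. Qed.

Lemma tameS W m b F : tame W m.+1 b F -> tame W m b F.
Proof.
elim: m b F => [|m IH] b F [cF bF dF]; split => // i ib.
by have [dFi tF] := dF i ib; split => //; exact: IH.
Qed.

Lemma tame_sub W m b c F : (c <= b)%N -> tame W m b F -> tame W m c F.
Proof.
case: m => [|m] cb [cF bF dF]; split => // i ic.
by apply: dF; exact: leq_trans cb.
Qed.

Lemma tameD W m b F G : tame W m b F -> tame W m b G ->
  tame W m b (fun x t => F x t + G x t).
Proof.
elim: m b F G => [|m IH] b F G [cF [C bF] dF] [cG [D bG] dG]; split => //.
- by move=> x; move=> t; apply: continuousD; [exact: cF|exact: cG].
- exists (C + D) => x t; rewrite mulrDl (le_trans (ler_normD _ _))//.
  exact: lerD.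
- by move=> x; move=> t; apply: continuousD; [exact: cF|exact: cG].
- exists (C + D) => x t; rewrite mulrDl (le_trans (ler_normD _ _))//.
  exact: lerD.
- move=> i ib; have [dFi tF] := dF i ib; have [dGi tG] := dG i ib; split.
    by move=> x t; exact: derivableD.
  rewrite (_ : (fun _ _ => _) =
    fun x t => 'D_(d_ i) (F x) t + 'D_(d_ i) (G x) t); first exact: IH.
  by apply/funext => x; apply/funext => t; exact: deriveD.
Qed.

(** By Leibniz' rule, decay of one factor and boundedness of the other suffice. *)
Lemma tameM W m b F G : tame W m b F -> tame (fun=> 1) m b G ->
  tame W m b (fun x t => F x t * G x t).
Proof.
elim: m b F G => [|m IH] b F G tF tG.
all: have [cF [C bF] dF] := tF; have [cG [D bG] dG] := tG.
all: have cFG x : continuous (fun t => F x t * G x t)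
  by move=> t; apply: continuousM; [exact: cF|exact: cG].
all: have bFG : exists E, forall x t, `|F x t * G x t| <= E * W t
  by (exists (C * D) => x t; rewrite normrM mulrAC ler_pM// -[D]mulr1).
all: split => // i ib.
have [dFi tFi] := dF i ib; have [dGi tGi] := dG i ib; split.
  by move=> x t; exact: derivableM.
rewrite (_ : (fun _ _ => _) = fun x t =>
    'D_(d_ i) (F x) t * G x t + F x t * 'D_(d_ i) (G x) t); last first.
  apply/funext => x; apply/funext => t; rewrite deriveM// addrC.
  by rewrite mulrC.
apply: tameD; apply: IH => //.
- exact/(tame_sub ib)/tameS.
- exact/(tame_sub ib)/tameS.
Qed.

Lemma tame_cst m b (c : R) : tame (fun=> 1) m b (fun _ _ => c).
Proof.
elim: m b c => [|m IH] b c; split => //.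
- by move=> x; exact: cst_continuous.
- by exists `|c| => x t; rewrite mulr1.
- by move=> x; exact: cst_continuous.
- by exists `|c| => x t; rewrite mulr1.
- move=> i _; split; first by move=> x t; exact: derivable_cst.
  have := IH i 0; congr (tame _ _ _ _).
  by apply/funext => x; apply/funext => t; exact/esym/derive_cst.
Qed.

Lemma tameZ W m b (c : R) F : tame W m b F -> tame W m b (fun x t => F x t * c).
Proof. by move=> tF; exact/tameM/tame_cst. Qed.

Lemma tameB W m b F G : tame W m b F -> tame W m b G ->
  tame W m b (fun x t => F x t - G x t).
Proof.
move=> tF tG; rewrite (_ : (fun _ _ => _) = fun x t => F x t + G x t * -1).
  exact/tameD/tameZ.
by apply/funext => x; apply/funext => t; rewrite mulrN1.
Qed.

Definition ctame W m b (F : X -> 'rV[R]_n -> R[i]) :=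
  tame W m b (fun x t => complex.Re (F x t)) /\
  tame W m b (fun x t => complex.Im (F x t)).

Lemma ctameM W m b (F G : X -> 'rV[R]_n -> R[i]) :
  ctame W m b F -> ctame (fun=> 1) m b G ->
  ctame W m b (fun x t => F x t * G x t).
Proof.
move=> [F1 F2] [G1 G2]; split.
  rewrite (_ : (fun _ _ => _) = fun x t =>
    complex.Re (F x t) * complex.Re (G x t)
    - complex.Im (F x t) * complex.Im (G x t)); first by apply: tameB; exact: tameM.
  by apply/funext => x; apply/funext => t; rewrite ReM.
rewrite (_ : (fun _ _ => _) = fun x t =>
  complex.Re (F x t) * complex.Im (G x t)
  + complex.Im (F x t) * complex.Re (G x t)); first by apply: tameD; exact: tameM.
by apply/funext => x; apply/funext => t; rewrite ImM.
Qed.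

Lemma ctame_conj W m b (F : X -> 'rV[R]_n -> R[i]) :
  ctame W m b F -> ctame W m b (fun x t => (F x t)^*).
Proof.
move=> [F1 F2]; split.
  by under [X in tame _ _ _ X]eq_fun do under eq_fun do rewrite ReJ.
rewrite (_ : (fun _ _ => _) = fun x t => complex.Im (F x t) * -1).
  exact: tameZ.
by apply/funext => x; apply/funext => t; rewrite ImJ mulrN1.
Qed.

Lemma ctame_prod k m b (F : 'I_k -> X -> 'rV[R]_n -> R[i]) :
  (forall i, ctame (fun=> 1) m b (F i)) ->
  ctame (fun=> 1) m b (fun x t => \prod_(i < k) F i x t).
Proof.
elim: k F => [|k IH] F tF.
  have : ctame (fun=> 1) m b (fun (_ : X) (_ : 'rV[R]_n) => 1 : R[i]).
    by split; exact: tame_cst.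
  by congr ctame; apply/funext => x; apply/funext => t; rewrite big_ord0.
have := ctameM (tF ord0) (IH _ (fun i => tF (lift ord0 i))).
by congr ctame; apply/funext => x; apply/funext => t; rewrite big_ord_recl.
Qed.

(** Each derivative of a ridge function along a coordinate is a multiple of the
    ridge function with the next profile; shifting the profile by p changes no
    bound. *)
Lemma tame_ridge m b (w : 'rV[R]_n) (p : X -> R) (phi : nat -> R -> R) :
  (forall l (r : R), is_derive r 1 (phi l) (phi l.+1 r)) ->
  (forall l, exists C, forall r, `|phi l r| <= C) ->
  tame (fun=> 1) m b (fun x t => phi 0%N (dotp w t - p x)).
Proof.
move=> dphi bphi.
have cphi l : continuous (phi l).
  move=> r; apply/differentiable_continuous/derivable1_diffP.
  exact: ex_derive.
suff H l c : tame (fun=> 1) m b (fun x t => phi l (dotp w t - p x) * c).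
  have := H 0%N 1; congr (tame _ _ _ _).
  by apply/funext => x; apply/funext => t; rewrite mulr1.
elim: m b l c => [|m IH] b l c.
all: have ct x : continuous (fun t => phi l (dotp w t - p x) * c)
  by move=> t; apply: continuousM; last exact: cst_continuous;
     apply: (@continuous_comp _ _ _ (fun t => dotp w t - p x) (phi l));
     last exact: cphi; apply: continuousB; last exact: cst_continuous;
     exact: continuous_dotpr.
all: have bt : exists C, forall (x : X) t, `|phi l (dotp w t - p x) * c| <= C * 1
  by (have [C bC] := bphi l; exists (C * `|c|) => x t; rewrite mulr1 normrM ler_pM).
all: split => // i _.
have D x t : is_derive t (d_ i) (fun t => phi l (dotp w t - p x) * c)
    (phi l.+1 (dotp w t - p x) * (c * w 0 i)).
  apply: is_derive_line.
  rewrite (_ : (fun _ => _) =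
    (phi l \o (fun s => s * w 0 i + (dotp w t - p x))) * cst c); last first.
    apply/funext => s /=; rewrite !fctE/=; congr (phi l _ * _).
    by rewrite dotpC dotpDl dotpZl dotp_delta dotpC; ring.
  set a := dotp w t - p x.
  have da : is_derive (0 : R) 1 (fun s : R => s * w 0 i + a) (w 0 i).
    by apply: is_derive_eq; rewrite ?scaler0 ?add0r ?addr0 ?scaler1 ?mulr1.
  have dphi0 : is_derive ((fun s : R => s * w 0 i + a) 0) 1 (phi l) (phi l.+1 a).
    by rewrite mul0r add0r.
  apply: is_derive_eq; rewrite !fctE.
  by rewrite scaler0 add0r -[LHS]/(c * _) mulrCA.
split; first by move=> x t; exact: ex_derive.
have := IH i l.+1 (c * w 0 i); congr (tame _ _ _ _).
apply/funext => x; apply/funext => t.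
by rewrite (@derive_val _ _ _ _ _ _ _ (D x t)).
Qed.

End tame_families.

(** * Test functions give tame families *)
Section decaying_functions.
Context {R : realType}.

(** The order of differentiation used by [mderiv]. *)
Definition canon n (alpha : 'I_n -> nat) : seq 'I_n :=
  flatten [seq nseq (alpha i) i | i <- enum 'I_n].

Definition incr n (alpha : 'I_n -> nat) (i : 'I_n) : 'I_n -> nat :=
  fun j => if j == i then (alpha j).+1 else alpha j.

(** A derivative along an index at most all those already used extends the
    canonical list at its head, the place of the outermost derivative. *)
Lemma canon_incr n (alpha : 'I_n -> nat) (i : 'I_n) :
  (forall j : 'I_n, (j < i)%N -> alpha j = 0%N) ->
  canon (incr alpha i) = i :: canon alpha.
Proof.
move=> alpha0.
have se : pairwise (fun a b : 'I_n => (a < b)%N) (enum 'I_n).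
  rewrite -(pairwise_map (@nat_of_ord n) ltn) val_enum_ord.
  by rewrite -(sorted_pairwise ltn_trans) iota_ltn_sorted.
have ie : i \in enum 'I_n by rewrite mem_enum.
rewrite /canon; move: se; case/splitPr: ie => e1 e2.
rewrite pairwise_cat => /and3P[/allrelP lt1 _ /=/andP[/allP lt2 _]].
have z1 (beta : 'I_n -> nat) : (forall j, j \in e1 -> beta j = 0%N) ->
    flatten [seq nseq (beta j) j | j <- e1] = [::].
  elim: e1 {lt1} => // a e1 IH b0 /=; rewrite b0 ?mem_head//=.
  by apply: IH => j je; apply: b0; rewrite inE je orbT.
have lti j : j \in e1 -> (j < i)%N by move=> je; apply: lt1 => //; rewrite mem_head.
rewrite !map_cat !flatten_cat /= !z1 /=; last 2 first.
- by move=> j /lti; exact: alpha0.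
- move=> j /lti ji; rewrite /incr ifN; first exact: alpha0.
  by apply: contraTneq ji => ->; rewrite ltnn.
rewrite {1}/incr eqxx /=; congr (_ :: _ ++ flatten _).
apply/eq_in_map => j je; rewrite /incr ifN//.
by apply: contraTneq (lt2 _ je) => ->; rewrite ltnn.
Qed.

(** What the argument needs from either space of test functions. *)
Definition rapid n (f : 'rV[R]_n -> R[i]) : Prop :=
  csmooth f /\
  forall alpha, exists C, forall t, normc (mderiv alpha f t) <= C * cauchy t.

Lemma cauchy_le n (t : 'rV[R]_n) (a C : R) :
  a * (\prod_(j < n) oneDsqr (t 0 j)) <= C -> a <= C * cauchy t.
Proof.
by rewrite /cauchy prodfV ler_pdivlMr//; apply: prodr_gt0 => j _; exact: oneDsqr_gt0.
Qed.

(** prod_j (1 + t_j^2) expands into the monomials prod_(j in J) t_j^2, each of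
    which is controlled by a Schwartz seminorm. *)
Lemma schwartz_rapid n (f : 'rV[R]_n -> R[i]) : schwartz f -> rapid f.
Proof.
move=> [sf bf]; split => // alpha.
pose beta (J : {set 'I_n}) (i : 'I_n) := if i \in J then 2%N else 0%N.
have /choice[M hM] : forall J, exists M : R, forall t : 'rV[R]_n,
    \prod_i t 0 i ^+ beta J i * normc (mderiv alpha f t) <= M.
  move=> J; have [M hM] := bf alpha (beta J); exists M => t.
  apply: le_trans (hM _ (ex_intro _ t erefl)).
  by rewrite ler_wpM2r ?normc_ge0// ler_norm.
exists (\sum_J M J) => t; apply: cauchy_le.
rewrite mulrC; under eq_bigr do rewrite /oneDsqr addrC.
rewrite bigA_distr mulr_suml; apply: ler_sum => J _.
apply: le_trans (hM J t); rewrite le_eqVlt; apply/orP; left; apply/eqP.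
by congr (_ * _); apply: eq_bigr => i _; rewrite /beta; case: ifP.
Qed.

Lemma norm_coord_le n (t : 'rV[R]_n) j : `|t 0 j| <= enorm t.
Proof.
rewrite -sqrtr_sqr ler_wsqrtr// /dotp (bigD1 j)//= -expr2 lerDl.
by apply: sumr_ge0 => i _; rewrite -expr2 sqr_ge0.
Qed.

(** Each factor 1 + t_j^2 is at most (1 + |t|)^2 <= exp(2 |t|), so the seminorm of
    index at least 2n dominates their product. *)
Lemma K1_rapid n (f : 'rV[R]_n -> R[i]) : K1 f -> rapid f.
Proof.
move=> [sf bf]; split => // alpha.
pose m := maxn (n * 2) (\sum_(i < n) alpha i).
have [M hM] := bf m; exists M => t; apply: cauchy_le.
apply: le_trans (hM _ (ex_intro _ t (ex_intro _ alpha (conj (leq_maxr _ _) erefl)))).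
rewrite mulrC ler_wpM2r ?normc_ge0//.
have e0 : 0 <= enorm t by exact: sqrtr_ge0.
apply: (@le_trans _ _ (expR (enorm t * 2%:R) ^+ n)).
  rewrite -[X in _ ^+ X](card_ord n) -prodr_const; apply: ler_prod => j _.
  rewrite ltW ?oneDsqr_gt0//= expRM_natr.
  apply: (@le_trans _ _ ((1 + enorm t) ^+ 2)).
    have := norm_coord_le t j; rewrite /oneDsqr -(real_normK (num_real (t 0 j))).
    by have := normr_ge0 (t 0 j); nra.
  by rewrite lerXn2r ?nnegrE ?expR_ge0 ?expR_ge1Dx// addr_ge0.
rewrite -expRM_natr ler_expR -mulrA -natrM mulrC ler_wpM2r// ler_nat.
by rewrite mulnC leq_maxl.
Qed.

(** Indices never increase along [tame], so that the lists of derivatives met in the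
    induction are exactly the canonical ones. *)
Lemma tame_partials n m b (X : Type) (h : seq 'I_n -> 'rV[R]_n -> R) :
  (forall s i t, h (i :: s) t = 'D_(delta_mx 0 i) (h s) t) ->
  (forall s, continuous (h s) /\
     forall (i : 'I_n) t, derivable (h s) t (delta_mx 0 i)) ->
  (forall alpha, exists C, forall t, `|h (canon alpha) t| <= C * cauchy t) ->
  tame (@cauchy R n) m b (fun _ : X => h [::]).
Proof.
move=> hS sh bh.
suff H alpha : (forall j : 'I_n, (j < b)%N -> alpha j = 0%N) ->
    tame (@cauchy R n) m b (fun _ : X => h (canon alpha)).
  have := H (fun=> 0%N) (fun _ _ => erefl).
  by rewrite (_ : canon _ = [::])// /canon; elim: (enum _).
elim: m b alpha => [|m IH] b alpha a0.
all: have [cs ds] := sh (canon alpha).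
all: have bs : exists C, forall (x : X) t, `|h (canon alpha) t| <= C * cauchy t
  by (have [C bC] := bh alpha; exists C => _ t; exact: bC).
all: split => // i ib.
split; first by move=> _ t; exact: ds.
have ai (j : 'I_n) : (j < i)%N -> alpha j = 0%N.
  by move=> ji; apply: a0; exact: leq_trans ib.
rewrite (_ : (fun _ _ => _) = fun=> h (canon (incr alpha i))).
  apply: IH => j ji; rewrite /incr ifN; first exact: ai.
  by apply: contraTneq ji => ->; rewrite ltnn.
by apply/funext => x; apply/funext => t; rewrite canon_incr// hS.
Qed.

Lemma tame_rapid n m b (f : 'rV[R]_n -> R[i]) (X : Type) :
  rapid f -> ctame (@cauchy R n) m b (fun _ : X => f).
Proof.
move=> [[s1 s2] bf]; split.
  apply: (@tame_partials n m b X (fun s => iter_partial s (@complex.Re R \o f))) => //.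
  move=> alpha; have [C bC] := bf alpha; exists C => t.
  exact: le_trans (normc_Re (mderiv alpha f t)) (bC t).
apply: (@tame_partials n m b X (fun s => iter_partial s (@complex.Im R \o f))) => //.
move=> alpha; have [C bC] := bf alpha; exists C => t.
exact: le_trans (normc_Im (mderiv alpha f t)) (bC t).
Qed.

Lemma cauchy_le1 n (t : 'rV[R]_n) : cauchy t <= 1.
Proof.
apply: prodr_ile1 => j _; rewrite oneDsqrV_ge0/=.
by rewrite invf_le1 ?oneDsqr_gt0// oneDsqr_ge1.
Qed.

Lemma tame_ridge_partials n m b (X : Type) (h : seq 'I_1 -> 'rV[R]_1 -> R)
    (w : 'rV[R]_n) (p : X -> R) :
  (forall s i t, h (i :: s) t = 'D_(delta_mx 0 i) (h s) t) ->
  (forall s, continuous (h s) /\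
     forall (i : 'I_1) t, derivable (h s) t (delta_mx 0 i)) ->
  (forall alpha, exists C, forall t, `|h (canon alpha) t| <= C * cauchy t) ->
  tame (fun=> 1) m b (fun x t => h [::] (const_mx (dotp w t - p x))).
Proof.
move=> hS sh bh.
pose phi l (r : R) := h (nseq l ord0) (0 + r *: delta_mx 0 ord0).
have := @tame_ridge R n X m b w p phi.
rewrite (_ : (fun x t => phi 0%N _) =
  fun x t => h [::] (const_mx (dotp w t - p x))); last first.
  apply/funext => x; apply/funext => t; rewrite /phi /=; congr (h _ _).
  by apply/rowP => j; rewrite !mxE (ord1 j) add0r mulr1.
apply.
  move=> l r; rewrite {2}/phi (hS (nseq l ord0)).
  exact: derive_line ((sh (nseq l ord0)).2 ord0 _).
move=> l; have [C bC] := bh (fun=> l); exists C => r; rewrite /phi.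
have <- : canon (fun _ : 'I_1 => l) = nseq l ord0.
  by rewrite /canon enum_ordSl enum_ord0 /= cats0.
apply: le_trans (bC _) _.
rewrite -[leRHS]mulr1 ler_wpM2l ?cauchy_le1//.
by have := le_trans (normr_ge0 _) (bC 0); rewrite pmulr_lge0 ?cauchy_gt0.
Qed.

Lemma tame_rapid_ridge n m b (g : R -> R[i]) (X : Type) (w : 'rV[R]_n)
    (p : X -> R) :
  rapid (on_R1 g) -> ctame (fun=> 1) m b (fun x t => g (dotp w t - p x)).
Proof.
move=> [[s1 s2] bg].
rewrite (_ : (fun _ _ => _) =
  fun x t => on_R1 g (const_mx (dotp w t - p x))); last first.
  by apply/funext => x; apply/funext => t; rewrite /on_R1 mxE.
split.
  apply: (@tame_ridge_partials n m b X
    (fun s => iter_partial s (@complex.Re R \o on_R1 g))) => //.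
  move=> alpha; have [C bC] := bg alpha; exists C => t.
  exact: le_trans (normc_Re (mderiv alpha (on_R1 g) t)) (bC t).
apply: (@tame_ridge_partials n m b X
  (fun s => iter_partial s (@complex.Im R \o on_R1 g))) => //.
move=> alpha; have [C bC] := bg alpha; exists C => t.
exact: le_trans (normc_Im (mderiv alpha (on_R1 g) t)) (bC t).
Qed.

Lemma rapid1_continuous (g : R -> R[i]) : rapid (on_R1 g) ->
  continuous (fun r => complex.Re (g r)) /\ continuous (fun r => complex.Im (g r)).
Proof.
move=> rg.
have [/tame_continuous c1 /tame_continuous c2] :=
  @tame_rapid_ridge 1 0 0 g unit (delta_mx 0 ord0) (fun=> 0) rg.
have cl : continuous (fun r : R => (const_mx r : 'rV[R]_1)).
  move=> r; apply: cvg_row => j; rewrite mxE.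
  by under eq_fun do rewrite mxE; exact: cvg_id.
have E (q : R[i] -> R) : (fun r => q (g r)) =
    (fun t => q (g (dotp (delta_mx 0 ord0) t - 0))) \o
    (fun r : R => const_mx r : 'rV[R]_1).
  by apply/funext => r /=; rewrite dotp_delta mxE subr0.
split => r; rewrite E.
  exact: (continuous_comp (cl r) (c1 tt (const_mx r))).
exact: (continuous_comp (cl r) (c2 tt (const_mx r))).
Qed.

Lemma rapid1_bounded (g : R -> R[i]) : rapid (on_R1 g) ->
  exists C, forall r, normc (g r) <= C * (oneDsqr r)^-1.
Proof.
move=> [_ /(_ (fun=> 0%N))[C bC]]; exists C => r.
have := bC (const_mx r); rewrite /cauchy big_ord1 mxE.
have E : mderiv (fun=> 0%N) (on_R1 g) (const_mx r) = g r.
  rewrite /mderiv (_ : flatten _ = [::]); last by elim: (enum _).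
  by rewrite /= /on_R1 mxE; case: (g r).
by rewrite E.
Qed.

End decaying_functions.

(** * Decay of the Fourier transform *)
Section fourier_decay.
Context {R : realType} {n : nat}.
Notation leb := (@lebesgue_measure R).
Implicit Types (G : 'rV[R]_n -> R) (xi t : 'rV[R]_n) (c : R).

(** The shift c makes the sine a cosine, so that one real transform covers both
    components of the complex one. *)
Definition phase c xi t : R := 2 * pi * dotp t xi + c.

Definition ctrans G c xi : R :=
  \int[lebesgue_tuple n]_x (G (row_of_tuple x) * cos (phase c xi (row_of_tuple x))).

Lemma continuous_phase c xi : continuous (phase c xi).
Proof.
rewrite (_ : phase c xi = (fun t => 2 * pi * dotp t xi + c))//.
move=> t.
apply: (@continuousD _ _ _ (fun t => 2 * pi * dotp t xi) (fun=> c));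
  last exact: cst_continuous.
by apply: continuousM; [exact: cst_continuous|exact: continuous_dotp].
Qed.

Lemma continuous_wave G c xi : continuous G ->
  continuous (fun t => G t * cos (phase c xi t)).
Proof.
move=> cG t; apply: continuousM; first exact: cG.
apply: (@continuous_comp _ _ _ (phase c xi) cos); first exact: continuous_phase.
exact: continuous_cos.
Qed.

Lemma norm_mul_cos_le (a b theta : R) : `|a| <= b -> `|a * cos theta| <= b.
Proof.
move=> ab; rewrite normrM -[b]mulr1 ler_pM//.
by rewrite ler_norml cos_geN1 cos_le1.
Qed.

Lemma integrable_cauchy_dom G C : continuous G ->
  (forall t, `|G t| <= C * cauchy t) ->
  (lebesgue_tuple n).-integrable setT
    (EFin \o (fun x : n.-tuple R => G (row_of_tuple x))).
Proof.
move=> cG bG; apply: (rintegrable_dom _ _ (integrable_cauchy n C)).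
  exact: (measurable_row_continuous cG).
by move=> x; exact: bG.
Qed.

Lemma integrable_wave G C c xi : continuous G ->
  (forall t, `|G t| <= C * cauchy t) ->
  (lebesgue_tuple n).-integrable setT (EFin \o
   (fun x : n.-tuple R => G (row_of_tuple x) * cos (phase c xi (row_of_tuple x)))).
Proof.
move=> cG bG.
apply: (@integrable_cauchy_dom (fun t => G t * cos (phase c xi t)) C).
  exact: continuous_wave.
by move=> t; exact: norm_mul_cos_le.
Qed.

Lemma ctrans_le G C c xi : continuous G ->
  (forall t, `|G t| <= C * cauchy t) ->
  `|ctrans G c xi| <=
    \int[lebesgue_tuple n]_x (C * cauchy (row_of_tuple (x : n.-tuple R))).
Proof.
move=> cG bG; have iw := integrable_wave c xi cG bG.
apply: le_trans (le_normr_Rintegral _ iw) _ => //.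
apply: le_Rintegral => //.
- exact: (integrable_norm iw).
- exact: integrable_cauchy.
- by move=> x _; exact: norm_mul_cos_le.
Qed.

Lemma dotp_line t xi (j : 'I_n) (r : R) :
  dotp (t + r *: delta_mx 0 j) xi = dotp t xi + r * xi 0 j.
Proof. by rewrite dotpDl dotpZl dotp_delta. Qed.

Lemma cauchy_set_coord_le (x : n.-tuple R) (j : 'I_n) (r : R) :
  cauchy (row_of_tuple (set_coord x j r)) <= (oneDsqr r)^-1.
Proof.
rewrite cauchy_row (bigD1 j)//= tnth_mktuple eqxx.
rewrite ler_piMr ?oneDsqrV_ge0//; apply: prodr_ile1 => i _.
by rewrite oneDsqrV_ge0/= invf_le1 ?oneDsqr_gt0// oneDsqr_ge1.
Qed.

(** Integration by parts in the j-th variable: the boundary terms vanish because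
    of the decay. *)
Lemma ctrans_derive (j : 'I_n) G C D c xi :
  continuous G -> (forall t, `|G t| <= C * cauchy t) ->
  (forall t, derivable G t (delta_mx 0 j)) ->
  continuous ('D_(delta_mx 0 j) G) ->
  (forall t, `|'D_(delta_mx 0 j) G t| <= D * cauchy t) ->
  ctrans ('D_(delta_mx 0 j) G) c xi =
    - (2 * pi * xi 0 j) * ctrans G (c + pi / 2) xi.
Proof.
move=> cG bG dG cdG bdG.
pose a := 2 * pi * xi 0 j.
(* H is the derivative of G cos(phase) along the j-th axis: a quarter-period
   shift turns - sin into cos. *)
pose H t : R := 'D_(delta_mx 0 j) G t * cos (phase c xi t)
  + a * (G t * cos (phase (c + pi / 2) xi t)).
have cH : continuous H.
  move=> t; apply: (@continuousD _ _ _
    (fun t => 'D_(delta_mx 0 j) G t * cos (phase c xi t))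
    (fun t => a * (G t * cos (phase (c + pi / 2) xi t)))).
    exact: continuous_wave.
  apply: (@continuousM _ _ (fun=> a)); first exact: cst_continuous.
  exact: continuous_wave.
have bH t : `|H t| <= (D + `|a| * C) * cauchy t.
  rewrite mulrDl (le_trans (ler_normD _ _))// lerD ?norm_mul_cos_le//.
  by rewrite normrM -mulrA ler_wpM2l// norm_mul_cos_le.
suff : \int[lebesgue_tuple n]_x H (row_of_tuple x) = 0.
  rewrite /H RintegralD//; last 2 first.
  - exact: integrable_wave bdG.
  - exact: (integrableZl measurableT a (integrable_wave _ _ cG bG)).
  rewrite RintegralZl//; last exact: integrable_wave bG.
  by move=> /eqP; rewrite addr_eq0 => /eqP; rewrite mulNr.
apply: (@Rintegral_coord0 R n j (H \o @row_of_tuple R n) (D + `|a| * C)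
  (fun _ y => (oneDsqr y)^-1)).
- exact: measurable_row_continuous.
- by move=> _; exact: integrable_oneDsqrV.
- by move=> x; rewrite -cauchy_row; exact: bH.
move=> x.
pose t0 := row_of_tuple (set_coord x j 0).
have line r : row_of_tuple (set_coord x j r) = t0 + r *: delta_mx 0 j := row_set_coord x j r.
pose h (r : R) : R := H (t0 + r *: delta_mx 0 j).
pose P (r : R) : R := G (t0 + r *: delta_mx 0 j)
  * cos (phase c xi (t0 + r *: delta_mx 0 j)).
have cl : continuous (fun r : R => t0 + r *: delta_mx 0 j : 'rV[R]_n).
  move=> r; apply: cvg_row => i; rewrite !mxE; under eq_fun do rewrite !mxE.
  apply: cvgD; first exact: cvg_cst.
  by apply: cvgM; [exact: cvg_id|exact: cvg_cst].
have ch : continuous h.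
  by move=> r; apply: (continuous_comp (cl r)); exact: cH.
have bh r : `|h r| <= (D + `|a| * C) * (oneDsqr r)^-1.
  rewrite /h -line (le_trans (bH _))// ler_wpM2l ?cauchy_set_coord_le//.
  by have := le_trans (normr_ge0 _) (bH 0); rewrite pmulr_lge0 ?cauchy_gt0.
have bP r : `|P r| <= C * (oneDsqr r)^-1.
  rewrite /P -line norm_mul_cos_le// (le_trans (bG _))//.
  rewrite ler_wpM2l ?cauchy_set_coord_le//.
  by have := le_trans (normr_ge0 _) (bG 0); rewrite pmulr_lge0 ?cauchy_gt0.
have dP (r : R) : is_derive r 1 P (h r).
  have dG1 := derive_line (dG (t0 + r *: delta_mx 0 j)).
  have dph : is_derive r (1 : R)
      (fun s : R => phase c xi (t0 + s *: delta_mx 0 j)) a.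
    rewrite (_ : (fun _ => _) =
        fun s : R => s * a + (2 * pi * dotp t0 xi + c)); last first.
      by apply/funext => s; rewrite /phase dotp_line /a; ring.
    by apply: is_derive_eq; rewrite ?scaler0 ?add0r ?addr0 ?scaler1 ?mulr1.
  have dcos := is_derive1_comp (is_derive_cos _) dph.
  apply: is_derive_eq; rewrite /h /H /phase addrA.
  rewrite [cos (_ + pi / 2)]cosD cos_pihalf sin_pihalf /GRing.scale/=.
  by ring.
have limP (e : nat -> R) : (forall m, (e m) ^+ 2 = m%:R ^+ 2) ->
    P (e m) @[m --> \oo] --> 0.
  move=> em; apply/norm_cvg0P.
  apply: (@squeeze_cvgr _ _ _ _ (fun=> 0) (fun m => C * (oneDsqr (m%:R : R))^-1)).
  - apply: nearW => m; rewrite normr_ge0/=.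
    by have := bP (e m); rewrite {1}/oneDsqr em.
  - exact: cvg_cst.
  - rewrite -[X in _ --> X](mulr0 C); apply: cvgM; first exact: cvg_cst.
    exact: oneDsqrV_cvg.
transitivity (\int[leb]_r h r).
  by apply: eq_Rintegral => r _ /=; rewrite line.
rewrite (@Rintegral_pieces R h h P h P 0 0)//.
- by rewrite sub0r subr0 addNr.
- have ib : leb.-integrable setT
      (EFin \o (fun r : R => (D + `|a| * C) * (oneDsqr r)^-1)).
    exact: (integrableZl measurableT _ integrable_oneDsqrV).
  apply: (@rintegrable_dom _ (measurableTypeR R) R leb h _ _ bh ib).
  exact: continuous_measurable_fun.
- by apply: limP.
- by apply: limP => m; rewrite sqrrN.
Qed.

Lemma cosDpi_phase c xi t : cos (phase (c + pi / 2 + pi / 2) xi t) =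
  - cos (phase c xi t).
Proof.
rewrite (_ : phase _ _ _ = phase c xi t + pi) ?cosDpi//.
by rewrite /phase; field.
Qed.

Section family.
Context {X : Type}.
Implicit Types F : X -> 'rV[R]_n -> R.

(** The operator 1 - d_j^2, which the transform turns into multiplication by
    1 + (2 pi xi_j)^2 >= 1 + xi_j^2. *)
Definition lap (j : 'I_n) F : X -> 'rV[R]_n -> R := fun x t =>
  F x t - 'D_(delta_mx 0 j) ('D_(delta_mx 0 j) (F x)) t.

Lemma tame_lap (j : 'I_n) m F :
  tame (@cauchy R n) m.+2 j F -> tame (@cauchy R n) m j (lap j F).
Proof.
move=> tF; apply: tameB; first exact/tameS/tameS.
have [_ _ dF] := tF; have [_ tF1] := dF j (leqnn j).
by have [_ _ dF1] := tF1; have [_ tF2] := dF1 j (leqnn j).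
Qed.

Lemma ctrans_lap (j : 'I_n) m F x c xi :
  tame (@cauchy R n) m.+2 j F ->
  ctrans (lap j F x) c xi =
    (1 + (2 * pi * xi 0 j) ^+ 2) * ctrans (F x) c xi.
Proof.
move=> tF; have [cF [C bF] dF] := tF; have [dF1 tF1] := dF j (leqnn j).
have [cF1 [C1 bF1] ddF] := tF1; have [dF2 tF2] := ddF j (leqnn j).
have cF2 := tame_continuous tF2; have [C2 bF2] := tame_bounded tF2.
transitivity (ctrans (F x) c xi -
    ctrans ('D_(delta_mx 0 j) ('D_(delta_mx 0 j) (F x))) c xi).
  rewrite /ctrans -RintegralB//.
  - by apply: eq_Rintegral => y _; rewrite mulrBl.
  - exact: (integrable_wave _ _ (cF x) (bF x)).
  - exact: (integrable_wave _ _ (cF2 x) (bF2 x)).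
rewrite (ctrans_derive c xi (cF1 x) (bF1 x) (dF2 x) (cF2 x) (bF2 x)).
rewrite (ctrans_derive (c + pi / 2) xi (cF x) (bF x) (dF1 x) (cF1 x) (bF1 x)).
have -> : ctrans (F x) (c + pi / 2 + pi / 2) xi = - ctrans (F x) c xi.
  rewrite /ctrans -mulN1r -RintegralZl//; last first.
    exact: (integrable_wave _ _ (cF x) (bF x)).
  by apply: eq_Rintegral => y _; rewrite cosDpi_phase mulrN mulN1r.
by ring.
Qed.

(** Each variable below b is treated once.  The largest index comes first, since
    [tame] only keeps control of derivatives along smaller or equal indices. *)
Lemma ctrans_decay_upto b F : (b <= n)%N -> tame (@cauchy R n) (b * 2) b.-1 F ->
  exists C, forall x c xi,
    (\prod_(j < n | (j < b)%N) (1 + (2 * pi * xi 0 j) ^+ 2))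
      * `|ctrans (F x) c xi| <= C.
Proof.
elim: b F => [|b IH] F bn tF.
  have cF := tame_continuous tF; have [C bF] := tame_bounded tF.
  eexists => x c xi; rewrite big_pred0// mul1r.
  exact: (ctrans_le c xi (cF x) (bF x)).
pose j := Ordinal bn.
have tL : tame (@cauchy R n) (b * 2) b.-1 (lap j F).
  by apply: (@tame_sub _ _ _ _ _ b); [exact: leq_pred|exact: (tame_lap (j := j))].
have [C bL] := IH _ (ltnW bn) tL; exists C => x c xi.
apply: le_trans (bL x c xi).
rewrite (bigD1 j)//= (@ctrans_lap j (b * 2) F)// normrM.
rewrite [`|1 + _|]ger0_norm ?addr_ge0 ?sqr_ge0//.
rewrite mulrCA mulrA (eq_bigl (fun i : 'I_n => (i < b)%N))// => i.
by rewrite -val_eqE /= ltnS [RHS]ltn_neqAle andbC.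
Qed.

Lemma ctrans_decay F : tame (@cauchy R n) (n * 2) n.-1 F ->
  exists C, forall x c xi, `|ctrans (F x) c xi| <= C * cauchy xi.
Proof.
move=> tF; have [C bC] := ctrans_decay_upto (leqnn n) tF.
exists C => x c xi; apply: cauchy_le; apply: le_trans (bC x c xi).
rewrite mulrC ler_wpM2r// [leRHS](eq_bigl predT); last by move=> j; exact: ltn_ord.
apply: ler_prod => j _; rewrite ltW ?oneDsqr_gt0//= /oneDsqr lerD2l.
rewrite exprMn ler_peMl ?sqr_ge0//.
by have := pi_ge2 R; nra.
Qed.

End family.
End fourier_decay.

(** * The complex Fourier transform *)
Section parameter_integral.
Context d1 d2 (T1 : measurableType d1) (T2 : measurableType d2) {R : realType}.
Variable m2 : {sigma_finite_measure set T2 -> \bar R}.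

(** Tonelli's theorem applied to the positive and negative parts: measurability
    holds even where the integral diverges. *)
Lemma measurable_Rintegral_param (h : T1 * T2 -> R) :
  measurable_fun setT h -> measurable_fun setT (fun x => \int[m2]_y h (x, y)).
Proof.
move=> mh; have mE : measurable_fun setT (EFin \o h) by exact/measurable_EFinP.
apply: (measurableT_comp (f := @fine R)) => //.
rewrite (_ : (fun _ => _) = (fun x =>
    \int[m2]_y (EFin \o h)^\+ (x, y) - \int[m2]_y (EFin \o h)^\- (x, y))%E).
  apply: emeasurable_funB; apply: measurable_fun_fubini_tonelli_F => //.
    exact: measurable_funepos.
  exact: measurable_funeneg.
apply/funext => x; rewrite integralE; congr (_ - _)%E; congr integral.
  exact: (funepos_comp (EFin \o h) (pair x)).
exact: (funeneg_comp (EFin \o h) (pair x)).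
Qed.

Lemma cmeas_cintegral_param (h : T1 * T2 -> R[i]) :
  cmeas h -> cmeas (fun x => cintegral m2 (fun y => h (x, y))).
Proof.
by move=> [h1 h2]; split; [exact: (measurable_Rintegral_param h1)|
                           exact: (measurable_Rintegral_param h2)].
Qed.

End parameter_integral.

Section fourier_transform.
Context {R : realType} {n : nat}.
Implicit Types (F : 'rV[R]_n -> R[i]) (xi t : 'rV[R]_n).

Definition fourier F xi : R[i] :=
  integral_Rn (fun t => F t * expi (- (2 * pi * dotp t xi))).

Let norm_add_pair (a b c d K L : R) : `|a| <= K -> `|b| <= L ->
  `|c| <= K -> `|d| <= L ->
  normc ((a + b) +i* (c + d)) <= (K + L) + (K + L).
Proof.
move=> aK bL cK dL; apply: le_trans (normc_ReIm _) _ => /=.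
by apply: lerD; apply: le_trans (ler_normD _ _) _; exact: lerD.
Qed.

Lemma fourier_decay (X : Type) (F : X -> 'rV[R]_n -> R[i]) :
  ctame (@cauchy R n) (n * 2) n.-1 F ->
  exists C, forall x xi, normc (fourier (F x) xi) <= C * cauchy xi.
Proof.
move=> [tF1 tF2].
have [C1 bC1] := ctrans_decay tF1; have [C2 bC2] := ctrans_decay tF2.
have [D1 bF1] := tame_bounded tF1; have [D2 bF2] := tame_bounded tF2.
exists ((C1 + C2) + (C1 + C2)) => x xi.
have cF1 := tame_continuous tF1; have cF2 := tame_continuous tF2.
have w1 c := integrable_wave c xi (cF1 x) (bF1 x).
have w2 c := integrable_wave c xi (cF2 x) (bF2 x).
have -> : fourier (F x) xi =
    (ctrans (fun t => complex.Re (F x t)) 0 xi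
       + ctrans (fun t => complex.Im (F x t)) (- (pi / 2)) xi) +i*
    (ctrans (fun t => complex.Re (F x t)) (pi / 2) xi
       + ctrans (fun t => complex.Im (F x t)) 0 xi).
  rewrite /fourier /integral_Rn /cintegral /ctrans; congr (_ +i* _).
    rewrite -RintegralD//; apply: eq_Rintegral => y _ /=.
    rewrite ReM /= cosN sinN /phase addr0 cosB cos_pihalf sin_pihalf.
    by ring.
  rewrite -RintegralD//; apply: eq_Rintegral => y _ /=.
  rewrite ImM /= cosN sinN /phase addr0 cosD cos_pihalf sin_pihalf.
  by ring.
by rewrite !mulrDl; apply: norm_add_pair.
Qed.

End fourier_transform.

(** * The Poisson kernel *)
Section poisson_kernel.
Context {R : realType}.
Notation leb := (@lebesgue_measure R).

(** The factor of Abel summation. *)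
Definition abel (e y : R) : R := expR (- (e * `|y|)).

Lemma abel_ge0 e y : 0 <= abel e y. Proof. exact: expR_ge0. Qed.

Lemma abel_dominated (e : R) : 0 < e ->
  exists2 C, 0 <= C & forall y, abel e y <= C * (oneDsqr y)^-1.
Proof.
move=> e0; exists (1 + 2 / e ^+ 2).
  by rewrite addr_ge0 ?divr_ge0 ?sqr_ge0.
move=> y; rewrite /abel expRN ler_pdivlMr ?oneDsqr_gt0// mulrC.
rewrite ler_pdivrMr ?expR_gt0//.
have ey : 0 <= e * `|y| by rewrite mulr_ge0// ltW.
(* The constant comes from exp(z) >= 1 + z^2 / 2 at z = e |y|. *)
apply: (@le_trans _ _ ((1 + 2 / e ^+ 2) * (1 + (e * `|y|) ^+ 2 / 2))).
  rewrite exprMn real_normK ?num_real// /oneDsqr.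
  rewrite [leRHS](_ : _ = 1 + y ^+ 2 + (2 / e ^+ 2 + e ^+ 2 * y ^+ 2 / 2)).
    rewrite lerDl addr_ge0 ?divr_ge0 ?sqr_ge0//.
    by rewrite mulr_ge0 ?sqr_ge0.
  by field; rewrite gt_eqF.
rewrite ler_wpM2l//; first by rewrite addr_ge0 ?divr_ge0 ?sqr_ge0.
exact: (expR_ge1Dxn 1).
Qed.

Lemma continuous_abel e : continuous (abel e).
Proof.
move=> y; apply: (@continuous_comp _ _ _ (fun y => - (e * `|y|)) expR).
  apply: continuousN; apply: (@continuousM _ _ (fun=> e)).
    exact: cst_continuous.
  exact: norm_continuous.
exact: continuous_expR.
Qed.

Lemma integrable_abel (e : R) : 0 < e ->
  leb.-integrable setT (EFin \o abel e).
Proof.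
move=> e0; have [C _ bC] := abel_dominated e0.
have ib : leb.-integrable setT (EFin \o (fun y : R => C * (oneDsqr y)^-1)).
  exact: (integrableZl measurableT _ integrable_oneDsqrV).
apply: (@rintegrable_dom _ (measurableTypeR R) R leb (abel e) _ _ _ ib).
  by apply: continuous_measurable_fun; exact: continuous_abel.
by move=> y; rewrite ger0_norm ?abel_ge0.
Qed.

(** An antiderivative of exp(-ey) cos(ay+c). *)
Let prim (e a c y : R) : R := expR (- (e * y)) *
  (a * sin (y * a + c) - e * cos (y * a + c)) / (e ^+ 2 + a ^+ 2).

Let is_derive_prim (e a c y : R) : e != 0 ->
  is_derive y 1 (prim e a c) (expR (- (e * y)) * cos (y * a + c)).
Proof.
move=> e0.
have dl : is_derive y (1 : R) (fun y : R => y * a + c) a.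
  by apply: is_derive_eq; rewrite ?scaler0 ?add0r ?addr0 ?scaler1 ?mulr1.
have dc := is_derive1_comp (is_derive_cos _) dl.
have ds := is_derive1_comp (is_derive_sin _) dl.
have de' : is_derive y (1 : R) (fun y : R => - (e * y)) (- e).
  by apply: is_derive_eq; rewrite ?scaler0 ?add0r ?addr0 ?scaler1 ?mulr1.
have de := is_derive1_comp (is_derive_expR _) de'.
rewrite (_ : prim e a c = ((expR \o (fun y : R => - (e * y))) *
  (cst a * (sin \o (fun y : R => y * a + c))
   - cst e * (cos \o (fun y : R => y * a + c)))) * cst (e ^+ 2 + a ^+ 2)^-1)//.
apply: is_derive_eq; rewrite /GRing.scale/= !fctE/=.
field.
by rewrite gt_eqF// ltr_pwDl ?sqr_ge0// exprn_even_gt0.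
Qed.

Let prim_cvg (e e' a c : R) (s : nat -> R) : 0 < e ->
  (forall m, expR (- (e' * s m)) = abel e m%:R) ->
  prim e' a c (s m) @[m --> \oo] --> 0.
Proof.
move=> e0 sE; have [C _ bC] := abel_dominated e0.
pose K := (`|a| + `|e'|) * `|(e' ^+ 2 + a ^+ 2)^-1|.
apply/norm_cvg0P.
apply: (@squeeze_cvgr _ _ _ _ (fun=> 0)
  (fun m => K * C * (oneDsqr (m%:R : R))^-1)).
- apply: nearW => m; rewrite normr_ge0/= /prim sE -mulrA normrM.
  rewrite ger0_norm ?abel_ge0// mulrC -[leRHS]mulrA ler_pM ?abel_ge0//.
  rewrite /K normrM ler_wpM2r// (le_trans (ler_normB _ _))//.
  by rewrite !normrM lerD// -[leRHS]mulr1 ler_wpM2l// ler_norml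
     ?sin_geN1 ?sin_le1 ?cos_geN1 ?cos_le1.
- exact: cvg_cst.
- rewrite -[X in _ --> X](mulr0 (K * C)); apply: cvgM; first exact: cvg_cst.
  exact: oneDsqrV_cvg.
Qed.

(** On the two half-lines the primitives are [prim] for e and for - e; at 0 their
    sine terms cancel. *)
Lemma abel_cos (e a c : R) : 0 < e ->
  \int[leb]_y (abel e y * cos (y * a + c)) =
  2 * e / (e ^+ 2 + a ^+ 2) * cos c.
Proof.
move=> e0.
have ccos : continuous (fun y : R => cos (y * a + c)).
  move=> y; apply: (@continuous_comp _ _ _ (fun y : R => y * a + c) (@cos R)).
    apply: cvgD; last exact: cvg_cst.
    by apply: cvgM; [exact: cvg_id|exact: cvg_cst].
  exact: continuous_cos.
have cg (e' : R) : continuous (fun y : R => expR (- (e' * y)) * cos (y * a + c)).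
  move=> y; apply: cvgM; last exact: ccos.
  apply: (@continuous_comp _ _ _ (fun y : R => - (e' * y)) (@expR R)).
    by apply: cvgN; apply: cvgM; [exact: cvg_cst|exact: cvg_id].
  exact: continuous_expR.
have ih : leb.-integrable setT
    (EFin \o (fun y : R => abel e y * cos (y * a + c))).
  apply: (@rintegrable_dom _ (measurableTypeR R) R leb _ _ _ _
    (integrable_abel e0)).
    apply: continuous_measurable_fun => y; apply: cvgM; last exact: ccos.
    exact: continuous_abel.
  by move=> y; rewrite norm_mul_cos_le// ger0_norm ?abel_ge0.
have h1 (y : R) : 0 <= y ->
    abel e y * cos (y * a + c) = expR (- (e * y)) * cos (y * a + c).
  by move=> y0; rewrite /abel ger0_norm.
have h2 (y : R) : y <= 0 ->
    abel e y * cos (y * a + c) = expR (- (- e * y)) * cos (y * a + c).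
  by move=> y0; rewrite /abel ler0_norm// mulrN mulNr.
have d1 (y : R) := @is_derive_prim e a c y (lt0r_neq0 e0).
have d2 (y : R) := @is_derive_prim (- e) a c y (ltr0_neq0 (etrans (oppr_lt0 e) e0)).
have l1 : prim e a c n%:R @[n --> \oo] --> 0.
  by apply: (prim_cvg (e := e)) => // m; rewrite /abel ger0_norm.
have l2 : prim (- e) a c (- n%:R) @[n --> \oo] --> 0.
  by apply: (prim_cvg (e := e)) => // m; rewrite /abel ger0_norm// mulrNN.
rewrite (Rintegral_pieces ih h1 h2 (cg e) (cg (- e)) d1 d2 l1 l2).
rewrite /prim !mulr0 oppr0 expR0 !mul0r !add0r sqrrN; field.
by rewrite gt_eqF// ltr_pwDl ?sqr_ge0// exprn_gt0.
Qed.

(** The Fourier transform of the Abel factor. *)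
Definition poisson (e y : R) : R := 2 * e / (e ^+ 2 + (2 * pi * y) ^+ 2).

Lemma cintegrable_abel_wave (e a : R) : 0 < e ->
  cintegrable leb (fun y => (abel e y)%:C * expi (y * a)).
Proof.
move=> e0; apply: (cintegrable_dom _ _ (integrable_abel e0)).
  apply: cmeasM.
    by apply: cmeas_real; apply: continuous_measurable_fun; exact: continuous_abel.
  by apply: cmeas_expi; apply: measurable_funM.
by move=> y; rewrite Normc.normcM normc_expi mulr1 normc_real ger0_norm ?abel_ge0.
Qed.

Lemma abel_transform (e y : R) : 0 < e ->
  cintegral leb (fun s => (abel e s)%:C * expi (s * (2 * pi * y))) =
  (poisson e y)%:C.
Proof.
move=> e0; apply: complex_ext.
  transitivity (\int[leb]_s (abel e s * cos (s * (2 * pi * y) + 0))).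
    by apply: eq_Rintegral => s _; rewrite ReM /= mul0r subr0 addr0.
  by rewrite abel_cos// cos0 mulr1.
transitivity (\int[leb]_s (abel e s * cos (s * (2 * pi * y) + - (pi / 2)))).
  apply: eq_Rintegral => s _; rewrite ImM /= mul0r addr0.
  by rewrite cosB cos_pihalf sin_pihalf mulr0 add0r mulr1.
by rewrite abel_cos// cosN cos_pihalf mulr0.
Qed.

Lemma poisson_scale (e y : R) : 0 < e -> e * poisson e (e * y) = poisson 1 y.
Proof.
move=> e0; rewrite /poisson; field; apply/andP; split.
  by rewrite gt_eqF// ltr_pwDl ?ltr01// sqr_ge0.
by rewrite gt_eqF// ltr_pwDl ?exprn_gt0// sqr_ge0.
Qed.

Lemma poisson1_ge0 (y : R) : 0 <= poisson 1 y.
Proof. by rewrite divr_ge0// addr_ge0 ?sqr_ge0// expr1n. Qed.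

Lemma continuous_poisson1 : continuous (poisson 1 : R -> R).
Proof.
move=> y; apply: cvgM; first exact: cvg_cst.
apply: cvgV; first by rewrite gt_eqF// ltr_pwDl ?expr1n// sqr_ge0.
apply: cvgD; first exact: cvg_cst.
apply: (@continuous_comp _ _ _ (fun y : R => 2 * pi * y) (fun y : R => y ^+ 2)).
  by apply: cvgM; [exact: cvg_cst|exact: cvg_id].
exact: exprn_continuous.
Qed.

Lemma integrable_poisson1 : leb.-integrable setT (EFin \o (poisson 1 : R -> R)).
Proof.
have ib : leb.-integrable setT (EFin \o (fun y : R => 2 * (oneDsqr y)^-1)).
  exact: (integrableZl measurableT _ integrable_oneDsqrV).
apply: (@rintegrable_dom _ (measurableTypeR R) R leb _ _ _ _ ib).
  by apply: continuous_measurable_fun; exact: continuous_poisson1.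
move=> y; rewrite ger0_norm ?poisson1_ge0// /poisson mulr1 expr1n ler_wpM2l//.
rewrite lef_pV2 ?posrE ?oneDsqr_gt0 ?ltr_pwDl ?sqr_ge0// /oneDsqr lerD2l.
by rewrite exprMn ler_peMl ?sqr_ge0//; have := pi_ge2 R; nra.
Qed.

(** The primitive is atan(2 pi y) / pi, with limits 1/2 and - 1/2. *)
Lemma Rintegral_poisson1 : \int[leb]_y poisson 1 y = 1 :> R.
Proof.
pose G (y : R) := atan (y * (2 * pi)) / pi.
have p0 : (pi : R) != 0 by rewrite gt_eqF// pi_gt0.
have dG_ (p y : R) : p != 0 ->
    is_derive y 1 (fun y => atan (y * (2 * p)) / p)
      (2 * 1 / (1 ^+ 2 + (2 * p * y) ^+ 2)).
  move=> pn0; have dl : is_derive y (1 : R) (fun y : R => y * (2 * p)) (2 * p).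
    by apply: is_derive_eq; rewrite ?scaler0 ?add0r ?addr0 ?scaler1 ?mulr1.
  have da := is_derive1_comp (is_derive1_atan _) dl.
  rewrite (_ : (fun _ => _) =
    (@atan R \o (fun y : R => y * (2 * p))) * cst p^-1)//.
  apply: is_derive_eq; rewrite /GRing.scale/= mulr0 add0r.
  by field; rewrite pn0 /= gt_eqF// ltr_pwDl ?ltr01// sqr_ge0.
have dG (y : R) : is_derive y 1 G (poisson 1 y) by exact: dG_.
have lim1 : G n%:R @[n --> \oo] --> (2^-1 : R).
  rewrite (_ : 2^-1 = pi / 2 / pi :> R); last by rewrite mulrAC divff ?mul1r.
  apply: cvgM; last exact: cvg_cst.
  have cy : (n%:R * (2 * pi) : R) @[n --> \oo] --> +oo.
    have pi2_gt0 : 0 < 2 * pi :> R by rewrite mulr_gt0// pi_gt0.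
    exact: (cvg_comp _ _ (@cvgr_idn R) (gt0_cvgMly pi2_gt0 cvg_id)).
  exact: (cvg_comp (fun n : nat => n%:R * (2 * pi)) (@atan R) cy (@cvgy_atan R)).
have lim2 : G (- n%:R) @[n --> \oo] --> (- 2^-1 : R).
  rewrite (_ : (fun n : nat => G (- n%:R)) = (fun n : nat => - G n%:R)).
    exact: cvgN.
  by apply/funext => n; rewrite /G mulNr atanN mulNr.
rewrite (Rintegral_pieces integrable_poisson1 (fun _ _ => erefl)
  (fun _ _ => erefl) continuous_poisson1 continuous_poisson1 dG dG lim1 lim2).
by rewrite /G mul0r atan0 !mul0r; lra.
Qed.

End poisson_kernel.

(** * Fourier inversion *)
Section inversion.
Context {R : realType} {n : nat}.
Notation leb := (@lebesgue_measure R).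
Implicit Types (F : 'rV[R]_n -> R[i]) (xi t : 'rV[R]_n).

Lemma ReMr (z : R[i]) (a : R) : complex.Re (z * a%:C) = complex.Re z * a.
Proof. by rewrite ReM /= mulr0 subr0. Qed.

Lemma ImMr (z : R[i]) (a : R) : complex.Im (z * a%:C) = complex.Im z * a.
Proof. by rewrite ImM /= mulr0 add0r. Qed.

Lemma measurable_dotp d (T : measurableType d) (f g : T -> n.-tuple R) :
  measurable_fun setT f -> measurable_fun setT g ->
  measurable_fun setT (fun x => dotp (row_of_tuple (f x)) (row_of_tuple (g x))).
Proof.
move=> mf mg; rewrite /dotp; apply: measurable_sum => i.
under eq_fun do rewrite !mxE.
apply: measurable_funM.
  exact: (measurableT_comp (measurable_tnth i) mf).
exact: (measurableT_comp (measurable_tnth i) mg).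
Qed.

Lemma cmeas_row F : continuous (fun t => complex.Re (F t)) ->
  continuous (fun t => complex.Im (F t)) ->
  cmeas (fun x : n.-tuple R => F (row_of_tuple x)).
Proof.
by move=> c1 c2; split; [exact: (measurable_row_continuous c1)|
                         exact: (measurable_row_continuous c2)].
Qed.

Lemma cmeas_fourier F : cmeas (fun x : n.-tuple R => F (row_of_tuple x)) ->
  cmeas (fun x : n.-tuple R => fourier F (row_of_tuple x)).
Proof.
move=> mF; apply: (cmeas_cintegral_param (lebesgue_tuple n)
  (h := fun p : n.-tuple R * n.-tuple R => F (row_of_tuple p.2) *
     expi (- (2 * pi * dotp (row_of_tuple p.2) (row_of_tuple p.1))))).
apply: cmeasM; first exact: (cmeas_comp mF measurable_snd).
apply: cmeas_expi; apply: measurable_funN; apply: measurable_funM.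
  exact: measurable_cst.
by apply: measurable_dotp.
Qed.

Definition tuple_of_row t : n.-tuple R := [tuple t 0 i | i < n].

Lemma tuple_of_rowK t : row_of_tuple (tuple_of_row t) = t.
Proof. by apply/rowP => i; rewrite mxE tnth_mktuple. Qed.

Lemma cauchy_bound_ge0 (g : 'rV[R]_n -> R[i]) (C : R) :
  (forall t, normc (g t) <= C * cauchy t) -> 0 <= C.
Proof.
move=> bg; have := le_trans (normc_ge0 _) (bg 0).
by rewrite pmulr_lge0// cauchy_gt0.
Qed.

Let wave F t xi := fourier F xi * expi (2 * pi * dotp t xi).

(** With the Abel factor the double integral in (xi, s) converges absolutely.
    Exchanging the integrals leaves, for each s, a product over the coordinates
    of one-dimensional transforms of the Abel factor at t_j - s_j. *)
Lemma fourier_abel F (C e : R) t : 0 < e ->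
  cmeas (fun x : n.-tuple R => F (row_of_tuple x)) ->
  (forall t, normc (F t) <= C * cauchy t) ->
  cintegral (lebesgue_tuple n) (fun y : n.-tuple R =>
    wave F t (row_of_tuple y) * (\prod_(j < n) abel e (tnth y j))%:C) =
  cintegral (lebesgue_tuple n) (fun x : n.-tuple R =>
    F (row_of_tuple x) * (\prod_(j < n) poisson e (t 0 j - tnth x j))%:C).
Proof.
move=> e0 mF bF.
pose A (y : n.-tuple R) := \prod_(j < n) abel e (tnth y j).
pose h (p : n.-tuple R * n.-tuple R) : R[i] :=
  F (row_of_tuple p.2) *
  expi (- (2 * pi * dotp (row_of_tuple p.2) (row_of_tuple p.1))) *
  (expi (2 * pi * dotp (row_of_tuple (tuple_of_row t)) (row_of_tuple p.1))
    * (A p.1)%:C).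
have mA : measurable_fun setT A.
  apply: (@measurable_prod_tnth _ _ (fun=> abel e)) => _.
  by apply: continuous_measurable_fun; exact: continuous_abel.
have iA : (lebesgue_tuple n).-integrable setT (EFin \o A).
  by apply: (@integrable_prod_tnth _ _ (fun=> abel e)) => _; exact: integrable_abel.
have A0 y : 0 <= A y by apply: prodr_ge0 => j _; exact: abel_ge0.
have m2 : cmeas (fun p : n.-tuple R * n.-tuple R => F (row_of_tuple p.2) *
     expi (- (2 * pi * dotp (row_of_tuple p.2) (row_of_tuple p.1)))).
  apply: cmeasM; first exact: (cmeas_comp mF measurable_snd).
  apply: cmeas_expi; apply: measurable_funN; apply: measurable_funM.
    exact: measurable_cst.
  by apply: measurable_dotp.
have mh : cmeas h.
  apply: cmeasM => //; apply: cmeasM.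
    apply: cmeas_expi; apply: measurable_funM; first exact: measurable_cst.
    by apply: measurable_dotp => //; exact: measurable_cst.
  by apply: cmeas_real; exact: (measurableT_comp mA measurable_fst).
have h_le y x : normc (h (y, x)) <= A y * (C * cauchy (row_of_tuple x)).
  rewrite /h !Normc.normcM !normc_expi mulr1 mul1r normc_real ger0_norm//.
  by rewrite mulrC ler_wpM2l.
have iFe y : cintegrable (lebesgue_tuple n) (fun x : n.-tuple R =>
    F (row_of_tuple x) *
    expi (- (2 * pi * dotp (row_of_tuple x) (row_of_tuple y)))).
  apply: (cintegrable_dom _ _ (integrable_cauchy n C)).
    exact: (cmeas_comp m2 (measurable_pair1 y)).
  by move=> x; rewrite Normc.normcM normc_expi mulr1.
transitivity (cintegral (lebesgue_tuple n) (fun y =>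
    cintegral (lebesgue_tuple n) (fun x => h (y, x)))).
  congr cintegral; apply/funext => y.
  by rewrite /h /= cintegralZr// tuple_of_rowK mulrA.
rewrite (cintegral_swap iA (integrable_cauchy n C) mh h_le).
congr cintegral; apply/funext => x.
have hE y : h (y, x) = F (row_of_tuple x) *
    \prod_(j < n) ((abel e (tnth y j))%:C *
      expi (tnth y j * (2 * pi * (t 0 j - tnth x j)))).
  rewrite /h /= -mulrA; congr (_ * _).
  rewrite mulrA -expiD mulrC tuple_of_rowK big_split /= -expi_sum; congr (_ * expi _).
    by rewrite /A rmorph_prod.
  rewrite /dotp !mulr_sumr -sumrN -big_split; apply: eq_bigr => j _.
  by rewrite !mxE /=; ring.
under [X in cintegral _ X]eq_fun do rewrite hE.
have iw j := @cintegrable_abel_wave R e (2 * pi * (t 0 j - tnth x j)) e0.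
rewrite cintegralZl.
  rewrite (cintegral_prod_tnth iw) rmorph_prod; congr (_ * _).
  by apply: eq_bigr => j _; exact: abel_transform.
apply: (cintegrable_dom _ _ iA).
  apply: cmeas_prod => j; apply: (cmeas_comp (cintegrable_meas (iw j))).
  exact: measurable_tnth.
move=> y; rewrite normc_prod /A; apply: ler_prod => j _.
rewrite normc_ge0 andTb Normc.normcM normc_expi mulr1 normc_real.
by rewrite ger0_norm ?abel_ge0.
Qed.

(** The substitution x = t - e y moves e from the kernel to the argument of F. *)
Lemma poisson_affine F (C e : R) t : 0 < e ->
  cmeas (fun x : n.-tuple R => F (row_of_tuple x)) ->
  (forall t, normc (F t) <= C * cauchy t) ->
  cintegral (lebesgue_tuple n) (fun x : n.-tuple R =>
    F (row_of_tuple x) * (\prod_(j < n) poisson e (t 0 j - tnth x j))%:C) =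
  cintegral (lebesgue_tuple n) (fun y : n.-tuple R =>
    F (row_of_tuple (affine e (tuple_of_row t) y)) *
    (\prod_(j < n) poisson 1 (tnth y j))%:C).
Proof.
move=> e0 mF bF.
have pe (y : R) : poisson e y = e^-1 * poisson 1 (y / e).
  by rewrite -(poisson_scale (y / e) e0) [e * (y / e)]mulrC divfK ?gt_eqF// mulKf ?gt_eqF.
have p1 (y : R) : 0 <= poisson 1 y <= 2.
  rewrite poisson1_ge0/= /poisson mulr1 expr1n ler_piMr//.
  by rewrite invf_le1 ?lerDl ?sqr_ge0// ltr_pwDl// sqr_ge0.
pose P (x : n.-tuple R) := \prod_(j < n) poisson e (t 0 j - tnth x j).
have mP : measurable_fun setT P.
  apply: (@measurable_prod_tnth _ _ (fun j y => poisson e (t 0 j - y))) => j.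
  under eq_fun do rewrite pe.
  apply: measurable_funM; first exact: measurable_cst.
  apply: (measurableT_comp (continuous_measurable_fun (@continuous_poisson1 R))).
  apply: measurable_funM; last exact: measurable_cst.
  by apply: measurable_funB; [exact: measurable_cst|exact: measurable_id].
have [K K0 bP] : exists2 K, 0 <= K & forall x, normc (P x)%:C <= K.
  exists ((2 / e) ^+ n); first by rewrite exprn_ge0// divr_ge0// ltW.
  move=> x; rewrite normc_real ger0_norm.
    rewrite -[X in _ ^+ X](card_ord n) -prodr_const; apply: ler_prod => j _.
    have /andP[a b] := p1 ((t 0 j - tnth x j) / e).
    by rewrite pe mulr_ge0 ?invr_ge0 ?(ltW e0)//= mulrC ler_wpM2r// invr_ge0 ltW.
  by apply: prodr_ge0 => j _; rewrite pe mulr_ge0 ?invr_ge0 ?(ltW e0)// poisson1_ge0.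
have [i1 i2] : cintegrable (lebesgue_tuple n)
    (fun x : n.-tuple R => F (row_of_tuple x) * (P x)%:C).
  apply: (cintegrable_dom _ _ (integrable_cauchy n (C * K))).
    by apply: cmeasM => //; exact: cmeas_real.
  by move=> x; rewrite Normc.normcM mulrAC ler_pM ?normc_ge0.
have PE y : e ^+ n * P (affine e (tuple_of_row t) y) =
    \prod_(j < n) poisson 1 (tnth y j).
  rewrite /P -[X in _ ^+ X](card_ord n) -prodr_const -big_split.
  apply: eq_bigr => j _ /=; rewrite !tnth_mktuple.
  by rewrite (_ : _ - _ = e * tnth y j) ?poisson_scale//; ring.
apply: complex_ext => /=.
  rewrite (Rintegral_affine (tuple_of_row t) e0 i1); apply: eq_Rintegral => y _.
  by rewrite !ReMr -PE mulrCA.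
rewrite (Rintegral_affine (tuple_of_row t) e0 i2); apply: eq_Rintegral => y _.
by rewrite !ImMr -PE mulrCA.
Qed.

Lemma integrable_prod_poisson1 :
  (lebesgue_tuple n).-integrable setT
    (EFin \o (fun y : n.-tuple R => \prod_(j < n) poisson 1 (tnth y j))).
Proof.
apply: (@integrable_prod_tnth R n (fun=> poisson 1)) => _.
exact: integrable_poisson1.
Qed.

Lemma cintegral_prod_poisson1 :
  cintegral (lebesgue_tuple n)
    (fun y : n.-tuple R => (\prod_(j < n) poisson 1 (tnth y j))%:C) = 1.
Proof.
have int1 : cintegral leb (fun y : R => (poisson 1 y)%:C) = 1.
  apply: complex_ext => /=; first exact: Rintegral_poisson1.
  by rewrite /Rintegral integral0.
have i1 : cintegrable leb (fun y : R => (poisson 1 y)%:C).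
  by split => /=; [exact: integrable_poisson1|exact: integrable0].
under [X in cintegral _ X]eq_fun do rewrite rmorph_prod.
rewrite (cintegral_prod_tnth (fun _ : 'I_n => i1)).
by under eq_bigr do rewrite int1; rewrite big1.
Qed.

(** As e tends to 0 along 1/(m+1), the left side of [fourier_abel] tends to the
    inversion integral, dominated thanks to the decay of the transform, and the
    right side of [poisson_affine] tends to F(t) times the total mass 1 of the
    kernel, by continuity and boundedness of F. *)
Lemma fourier_inversion F (C D : R) t :
  continuous (fun t => complex.Re (F t)) ->
  continuous (fun t => complex.Im (F t)) ->
  (forall t, normc (F t) <= C * cauchy t) ->
  (forall xi, normc (fourier F xi) <= D * cauchy xi) ->
  integral_Rn (fun xi => fourier F xi * expi (2 * pi * dotp t xi)) = F t.
Proof.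
move=> cF1 cF2 bF bFF.
have mF := cmeas_row cF1 cF2.
pose e (m : nat) : R := m.+1%:R^-1.
have e0 m : 0 < e m by rewrite invr_gt0.
have e_cvg : e m @[m --> \oo] --> 0 by exact: cvg_harmonic.
pose P (y : n.-tuple R) := \prod_(j < n) poisson 1 (tnth y j).
have P0 y : 0 <= P y by apply: prodr_ge0 => j _; exact: poisson1_ge0.
have mP : measurable_fun setT P.
  by apply/measurable_EFinP; exact: measurable_int integrable_prod_poisson1.
have mW : cmeas (fun y : n.-tuple R => wave F t (row_of_tuple y)).
  apply: cmeasM; first exact: cmeas_fourier.
  apply: cmeas_expi; apply: measurable_funM; first exact: measurable_cst.
  rewrite -[t]tuple_of_rowK.
  by apply: measurable_dotp => //; exact: measurable_cst.
have cA (y : n.-tuple R) :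
    \prod_(j < n) abel (e m) (tnth y j) @[m --> \oo] --> (1 : R).
  rewrite [X in _ --> X](_ : _ = \prod_(j < n) (1 : R)); last by rewrite big1.
  apply: (@cvg_big R 'I_n *%R 1 xpredT (@mul_continuous R) nat \oo
    (index_enum 'I_n) (fun j m => abel (e m) (tnth y j)) (fun=> 1)) => j _.
  rewrite /abel -[X in _ --> X]expR0.
  apply: (@continuous_cvg _ _ _ _ _ _ (@expR R)); first exact: continuous_expR.
  rewrite -[X in _ --> X]oppr0 -[X in _ --> - X](mul0r `|tnth y j|).
  by apply: cvgN; apply: cvgM => //; exact: cvg_cst.
have A01 m (y : n.-tuple R) : 0 <= \prod_(j < n) abel (e m) (tnth y j) <= 1.
  rewrite prodr_ge0/=; last by move=> j _; exact: abel_ge0.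
  apply: prodr_ile1 => j _; rewrite abel_ge0/= /abel expR_le1 oppr_le0.
  by rewrite mulr_ge0// ltW.
have bW xi : normc (wave F t xi) <= D * cauchy xi.
  by rewrite /wave Normc.normcM normc_expi mulr1.
have limL (p : R[i] -> R) :
    measurable_fun setT (fun y : n.-tuple R => p (wave F t (row_of_tuple y))) ->
    (forall z, `|p z| <= normc z) -> (forall z (a : R), p (z * a%:C) = p z * a) ->
    \int[lebesgue_tuple n]_y p (wave F t (row_of_tuple y) *
        (\prod_(j < n) abel (e m) (tnth y j))%:C) @[m --> \oo] -->
    \int[lebesgue_tuple n]_y p (wave F t (row_of_tuple y)).
  move=> mp pn pM; under eq_fun do under eq_Rintegral do rewrite pM.
  apply: (Rintegral_cvg _ _ (integrable_cauchy n D)).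
  - move=> m; apply: measurable_funM; first exact: mp.
    apply: (@measurable_prod_tnth _ _ (fun=> abel (e m))) => _.
    by apply: continuous_measurable_fun; exact: continuous_abel.
  - move=> m y; have /andP[a0 a1] := A01 m y.
    rewrite normrM (ger0_norm a0) -[leRHS]mulr1 ler_pM// (le_trans (pn _))//.
  - move=> y; rewrite -[X in _ --> X]mulr1; apply: cvgM; first exact: cvg_cst.
    exact: cA.
have limR (p : R[i] -> R) : continuous (fun t => p (F t)) ->
    (forall z, `|p z| <= normc z) -> (forall z (a : R), p (z * a%:C) = p z * a) ->
    \int[lebesgue_tuple n]_y p (F (row_of_tuple (affine (e m) (tuple_of_row t) y)) *
        (P y)%:C) @[m --> \oo] -->
    \int[lebesgue_tuple n]_y (p (F t) * P y).
  move=> cp pn pM; under eq_fun do under eq_Rintegral do rewrite pM.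
  have ib : (lebesgue_tuple n).-integrable setT (EFin \o (fun y => C * P y)).
    exact: (integrableZl measurableT C integrable_prod_poisson1).
  apply: (Rintegral_cvg _ _ ib).
  - move=> m; apply: measurable_funM; last exact: mP.
    exact: (measurableT_comp (measurable_row_continuous cp) (measurable_affine _ _)).
  - move=> m y; rewrite normrM (ger0_norm (P0 y)) ler_wpM2r//.
    apply: le_trans (pn _) (le_trans (bF _) _).
    by rewrite -[leRHS]mulr1 ler_wpM2l ?cauchy_le1// (cauchy_bound_ge0 bF).
  - move=> y; apply: cvgM; last exact: cvg_cst.
    apply: (continuous_cvg _ (cp t)); apply: cvg_row => j.
    rewrite (_ : (fun m => _) = (fun m => t 0 j - e m * tnth y j)); last first.
      by apply/funext => m; rewrite mxE !tnth_mktuple.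
    rewrite [X in _ --> X](_ : _ = t 0 j - 0 * tnth y j).
      by apply: cvgB; [exact: cvg_cst|apply: cvgM => //; exact: cvg_cst].
    by rewrite mul0r subr0.
have step m : cintegral (lebesgue_tuple n) (fun y : n.-tuple R =>
      wave F t (row_of_tuple y) * (\prod_(j < n) abel (e m) (tnth y j))%:C) =
    cintegral (lebesgue_tuple n) (fun y : n.-tuple R =>
      F (row_of_tuple (affine (e m) (tuple_of_row t) y)) * (P y)%:C).
  by rewrite (fourier_abel t (e0 m) mF bF) (poisson_affine t (e0 m) mF bF).
have intP : \int[lebesgue_tuple n]_y P y = 1.
  exact: (congr1 (@complex.Re R) cintegral_prod_poisson1).
have iP := integrable_prod_poisson1.
apply: complex_ext.
  have l1 := limL (@complex.Re R) mW.1 (@normc_Re R) ReMr.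
  have := limR (@complex.Re R) cF1 (@normc_Re R) ReMr.
  rewrite RintegralZl// intP mulr1 => l2; apply: (cvg_unique _ l1) => //=.
  have E m := congr1 (@complex.Re R) (step m).
  by rewrite (eq_cvg _ _ E).
have l1 := limL (@complex.Im R) mW.2 (@normc_Im R) ImMr.
have := limR (@complex.Im R) cF2 (@normc_Im R) ImMr.
rewrite RintegralZl// intP mulr1 => l2; apply: (cvg_unique _ l1) => //=.
have E m := congr1 (@complex.Im R) (step m).
by rewrite (eq_cvg _ _ E).
Qed.

End inversion.

(** * The directional short-time Fourier transform *)
Section directional_inversion.
Context {R : realType} {n k : nat}.
Notation leb := (@lebesgue_measure R).
Variables (u : 'I_k -> 'rV[R]_n) (f : 'rV[R]_n -> R[i]).
Variables (g psi : 'I_k -> R -> R[i]) (t : 'rV[R]_n).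
Hypotheses (rf : rapid f) (rg : forall i, rapid (on_R1 (g i)))
           (rpsi : forall i, rapid (on_R1 (psi i))).

(** [DS] at (x, xi) is by definition the Fourier transform of this at xi. *)
Definition windowed (x : 'rV[R]_k) (s : 'rV[R]_n) : R[i] :=
  f s * \prod_(i < k) (g i (dotp (u i) s - x 0 i))^*.

(** The windows slide with x, but their bounds do not depend on x; this is the
    source of all uniformity in x below. *)
Lemma ctame_windowed m b : ctame (@cauchy R n) m b windowed.
Proof.
apply: ctameM; first exact: tame_rapid.
apply: (@ctame_prod R n 'rV[R]_k k m b
  (fun i x s => (g i (dotp (u i) s - x 0 i))^*)) => i.
exact: (ctame_conj (tame_rapid_ridge m b (u i) (fun x : 'rV[R]_k => x 0 i) (rg i))).
Qed.

Lemma rapid_cmeas (a : R -> R[i]) : rapid (on_R1 a) -> cmeas a.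
Proof.
by move=> /rapid1_continuous[c1 c2]; split; exact: continuous_measurable_fun.
Qed.

Lemma rapid_cintegrable (a b : R -> R[i]) : rapid (on_R1 a) -> rapid (on_R1 b) ->
  cintegrable leb (fun s => (a s)^* * b s).
Proof.
move=> ra rb; have [A bA] := rapid1_bounded ra; have [B bB] := rapid1_bounded rb.
have ib : leb.-integrable setT (EFin \o (fun s : R => A * B * (oneDsqr s)^-1)).
  exact: (integrableZl measurableT _ integrable_oneDsqrV).
apply: (@cintegrable_dom _ (measurableTypeR R) R leb _ _ _ _ ib).
  by apply: cmeasM; [apply: cmeas_conj|]; exact: rapid_cmeas.
move=> s; rewrite Normc.normcM normc_conj -mulrA ler_pM ?normc_ge0//.
apply: le_trans (bA s) _; rewrite -[leRHS]mulr1 ler_wpM2l//.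
  have := le_trans (normc_ge0 _) (bA s).
  by rewrite pmulr_lge0// invr_gt0 oneDsqr_gt0.
by rewrite invf_le1 ?oneDsqr_gt0// oneDsqr_ge1.
Qed.

Let h (p : k.-tuple R * n.-tuple R) : R[i] :=
  DS g u f (row_of_tuple p.1) (row_of_tuple p.2) *
  psik psi u (row_of_tuple p.1) (row_of_tuple p.2) t.

Lemma cmeas_ridge (a : R -> R[i]) d (T : measurableType d) (s : T -> n.-tuple R)
    (x : T -> k.-tuple R) (i : 'I_k) :
  cmeas a -> measurable_fun setT s -> measurable_fun setT x ->
  cmeas (fun p => a (dotp (u i) (row_of_tuple (s p)) - tnth (x p) i)).
Proof.
move=> ma ms mx; apply: (cmeas_comp ma); apply: measurable_funB.
  rewrite -[u i]tuple_of_rowK.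
  by apply: measurable_dotp => //; exact: measurable_cst.
exact: (measurableT_comp (measurable_tnth i) mx).
Qed.

Let cmeas_h : cmeas h.
Proof.
have cf : cmeas (fun s : n.-tuple R => f (row_of_tuple s)).
  have [/tame_continuous c3 /tame_continuous c4] := @tame_rapid R n 0 0 f unit rf.
  exact: cmeas_row (c3 tt) (c4 tt).
apply: cmeasM.
  pose w (q : (k.-tuple R * n.-tuple R) * n.-tuple R) : R[i] :=
    f (row_of_tuple q.2) *
    (\prod_(i < k) (g i (dotp (u i) (row_of_tuple q.2) - tnth q.1.1 i))^*) *
    expi (- (2 * pi * dotp (row_of_tuple q.2) (row_of_tuple q.1.2))).
  have mw : cmeas w.
    apply: cmeasM; first apply: cmeasM.
    - exact: (cmeas_comp cf measurable_snd).
    - apply: cmeas_prod => i; apply: cmeas_conj; apply: cmeas_ridge => //.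
        exact: rapid_cmeas.
      exact: (measurableT_comp measurable_fst measurable_fst).
    - apply: cmeas_expi; apply: measurable_funN; apply: measurable_funM.
        exact: measurable_cst.
      apply: measurable_dotp => //.
      exact: (measurableT_comp measurable_snd measurable_fst).
  have := cmeas_cintegral_param (lebesgue_tuple n) mw.
  congr cmeas; apply/funext => p; rewrite /DS /integral_Rn.
  congr cintegral; apply/funext => s /=; rewrite /w /=.
  by congr (_ * _ * _); apply: eq_bigr => i _; rewrite mxE.
rewrite /psik; apply: cmeasM.
  under eq_fun do under eq_bigr do rewrite mxE.
  apply: cmeas_prod => i.
  apply: (cmeas_comp (rapid_cmeas (rpsi i))); apply: measurable_funB.
    exact: measurable_cst.
  exact: (measurableT_comp (measurable_tnth i) measurable_fst).
apply: cmeas_expi; apply: measurable_funM; first exact: measurable_cst.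
rewrite -[t]tuple_of_rowK.
by apply: measurable_dotp => //; exact: measurable_cst.
Qed.

Let shifted i : R := dotp (u i) t.

Let a (x : k.-tuple R) : R :=
  \prod_(i < k) (normc (psi i (shifted i - tnth x i))).

Let integrable_a : (lebesgue_tuple k).-integrable setT (EFin \o a).
Proof.
apply: (@integrable_prod_tnth R k (fun i y => normc (psi i (shifted i - y)))) => i.
apply: (@integrable_reflect R (shifted i) (fun y => normc (psi i y))).
have [B bB] := rapid1_bounded (rpsi i).
have ib : leb.-integrable setT (EFin \o (fun s : R => B * (oneDsqr s)^-1)).
  exact: (integrableZl measurableT _ integrable_oneDsqrV).
apply: (@rintegrable_dom _ (measurableTypeR R) R leb _ _ _ _ ib).
  have [m1 m2] := rapid_cmeas (rpsi i).
  rewrite (_ : (fun y => _) = (fun y => Num.sqrt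
    (complex.Re (psi i y) ^+ 2 + complex.Im (psi i y) ^+ 2))); last first.
    by apply/funext => y; case: (psi i y).
  apply: (measurableT_comp (continuous_measurable_fun (@sqrt_continuous R))).
  by apply: measurable_funD; exact: measurable_funX.
by move=> y; rewrite ger0_norm ?normc_ge0.
Qed.

(** The integrand is dominated by a(x) times a multiple of the weight in xi, so
    the xi-integral may be taken first, where Fourier inversion of the windowed
    function applies. *)
Lemma directional_stft_inversion :
  [/\ forall xi, integrable_Rn (fun x => DS g u f x xi * psik psi u x xi t),
      integrable_Rn (fun xi =>
        integral_Rn (fun x => DS g u f x xi * psik psi u x xi t)) &
      integral_Rn (fun xi =>
        integral_Rn (fun x => DS g u f x xi * psik psi u x xi t)) =
      f t * \prod_(i < k) pairing (g i) (psi i)].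
Proof.
have tw := ctame_windowed (n * 2) n.-1.
have [t1 t2] := tw.
have cw1 := tame_continuous t1; have cw2 := tame_continuous t2.
have [C1 bC1] := tame_bounded t1; have [C2 bC2] := tame_bounded t2.
have bW x s : normc (windowed x s) <= (C1 + C2) * cauchy s.
  by rewrite (le_trans (normc_ReIm _))// mulrDl lerD.
have [D bD] := fourier_decay tw.
have ib := integrable_cauchy n D.
have h_le x xi : normc (h (x, xi)) <= a x * (D * cauchy (row_of_tuple xi)).
  rewrite /h Normc.normcM mulrC /psik Normc.normcM normc_expi mulr1 normc_prod.
  rewrite ler_pM ?normc_ge0//; first by apply: prodr_ge0 => i _; exact: normc_ge0.
    by rewrite /a; under eq_bigr do rewrite mxE.
  exact: (bD (row_of_tuple x)).
have swap := cintegral_swap integrable_a ib cmeas_h h_le.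
split.
- move=> xi.
  have := cintegrable_dominated_r integrable_a cmeas_h h_le (tuple_of_row xi).
  by rewrite /h /= tuple_of_rowK.
- exact: (cintegrable_fubini_r integrable_a ib cmeas_h h_le).
rewrite /integral_Rn /comp -[LHS]swap.
transitivity (cintegral (lebesgue_tuple k) (fun x => f t * \prod_(i < k)
    ((g i (shifted i - tnth x i))^* * psi i (shifted i - tnth x i)))).
  congr cintegral; apply/funext => x; rewrite /h /psik /=.
  set Psi := \prod_i _.
  pose F := windowed (row_of_tuple x).
  transitivity (cintegral (lebesgue_tuple n) (fun xi : n.-tuple R =>
      Psi * (fourier F (row_of_tuple xi) *
             expi (2 * pi * dotp t (row_of_tuple xi))))).
    by congr cintegral; apply/funext => xi; rewrite mulrCA.
  rewrite cintegralZl; last first.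
    apply: (cintegrable_dom _ _ ib).
      apply: cmeasM.
        by apply: cmeas_fourier; apply: cmeas_row; [exact: cw1|exact: cw2].
      apply: cmeas_expi; apply: measurable_funM; first exact: measurable_cst.
      rewrite -[t]tuple_of_rowK.
      by apply: measurable_dotp => //; exact: measurable_cst.
    by move=> xi; rewrite Normc.normcM normc_expi mulr1; exact: bD.
  have := fourier_inversion t (cw1 (row_of_tuple x)) (cw2 (row_of_tuple x))
    (bW (row_of_tuple x)) (bD (row_of_tuple x)).
  rewrite /integral_Rn /comp => ->.
  rewrite /windowed mulrC -mulrA /Psi -big_split; congr (_ * _).
  by apply: eq_bigr => i _; rewrite mxE.
have igp i : cintegrable leb
    (fun y => (g i (shifted i - y))^* * psi i (shifted i - y)).
  have [i1 i2] := rapid_cintegrable (rg i) (rpsi i).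
  by split; [exact: (integrable_reflect (shifted i) i1)|
             exact: (integrable_reflect (shifted i) i2)].
have igpT : cintegrable (lebesgue_tuple k) (fun x : k.-tuple R =>
    \prod_(i < k) ((g i (shifted i - tnth x i))^* * psi i (shifted i - tnth x i))).
  pose b i (y : R) : R :=
    `|complex.Re ((g i (shifted i - y))^* * psi i (shifted i - y))| +
    `|complex.Im ((g i (shifted i - y))^* * psi i (shifted i - y))|.
  apply: (cintegrable_dom (b := fun x => \prod_(i < k) b i (tnth x i))).
  - apply: cmeas_prod => i.
    exact: (cmeas_comp (cintegrable_meas (igp i)) (measurable_tnth i)).
  - move=> x; rewrite normc_prod; apply: ler_prod => i _.
    by rewrite normc_ge0 normc_ReIm.
  - by apply: integrable_prod_tnth => i; exact: integrable_ReIm (igp i).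
rewrite cintegralZl//; congr (_ * _).
rewrite (cintegral_prod_tnth igp); apply: eq_bigr => i _.
have [i1 i2] := rapid_cintegrable (rg i) (rpsi i).
apply: complex_ext.
  exact: (Rintegral_reflect (shifted i) i1).
exact: (Rintegral_reflect (shifted i) i2).
Qed.

End directional_inversion.

Theorem proposition4p2 (R : realType) (n k : nat)
    (u : 'I_k -> 'rV[R]_n) (f : 'rV[R]_n -> R[i]) (g psi : 'I_k -> R -> R[i])
    (k_ge1 : (1 <= k)%N) (k_le_n : (k <= n)%N)
    (u_sphere : forall i, on_sphere (u i))
    (u_free : row_free (\matrix_(i < k) u i))
    (f_g_psi :
      (K1 f /\ forall i, K1 (on_R1 (g i)) /\ K1 (on_R1 (psi i))) \/
      (schwartz f /\
         forall i, schwartz (on_R1 (g i)) /\ schwartz (on_R1 (psi i))))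
    (pairing_neq0 : \prod_(i < k) pairing (g i) (psi i) <> 0) :
  forall t : 'rV[R]_n,
    [/\ forall xi, integrable_Rn (fun x => DS g u f x xi * psik psi u x xi t),
        integrable_Rn (fun xi =>
          integral_Rn (fun x => DS g u f x xi * psik psi u x xi t)) &
        f t = (\prod_(i < k) pairing (g i) (psi i))^-1 *
          integral_Rn (fun xi =>
            integral_Rn (fun x => DS g u f x xi * psik psi u x xi t))].
Proof.
move=> t.
have [rf [rg rpsi]] : rapid f /\ (forall i, rapid (on_R1 (g i))) /\
    (forall i, rapid (on_R1 (psi i))).
  case: f_g_psi => -[hf hgp]; split; [exact: K1_rapid| |exact: schwartz_rapid|].
    by split => i; have [h1 h2] := hgp i; exact: K1_rapid.
  by split => i; have [h1 h2] := hgp i; exact: schwartz_rapid.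
have [i1 i2 E] := directional_stft_inversion u t rf rg rpsi.
split => //; rewrite E mulrCA mulVf ?mulr1//.
exact/eqP.
Qed.
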